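(* For every partition $\lambda$, \[ g_\lambda(\mathbf x;\boldsymbol\alpha,\boldsymbol\beta)=\sum_{T\in\mathrm{MRPP}(\lambda)}\mathrm{wt}(T). \]
   Context: Parameters $\boldsymbol\alpha,\boldsymbol\beta$; $A_k=\alpha_1+\dots+\alpha_k$, $B_k=\beta_1+\dots+\beta_k$ ($k\ge1$), $A_k=B_k=0$ for $k\le0$. For a formal $\mathbb Z$-linear combination $Z=\sum_uc_uu$ of variables/parameters, $\sum_{m\ge0}h_m[Z]t^m=\prod_u(1-ut)^{-c_u}$, $h_m[Z]=0$ for $m<0$. For $\lambda$ with at most $n$ parts, $g_\lambda(x_1,\dots,x_n;\boldsymbol\alpha,\boldsymbol\beta)=\det(h_{\lambda_i+n-i}[x_j-A_{\lambda_i-1}+B_{i-1}])_{i,j=1}^n/\prod_{i<j}(x_i-x_j)$, and $g_\lambda(\mathbf x;\boldsymbol\alpha,\boldsymbol\beta)$ is the unique formal power series whose specialization $x_{n+1}=x_{n+2}=\dots=0$ is $g_\lambda(x_1,\dots,x_n;\boldsymbol\alpha,\boldsymbol\beta)$ for all $n\ge\ell(\lambda)$. A reverse plane partition of shape $\lambda/\mu$ is a filling by positive integers weakly increasing along rows and down columns. A (left-)marked reverse plane partition of shape $\lambda/\mu$ is a reverse plane partition $T$ in which each entry $T(i,j)$ such that $(i,j+1)$ is in the shape and $T(i,j)=T(i,j+1)$ may be marked; $\mathrm{MRPP}(\lambda/\mu)$ is the set of these. Its weight is $\mathrm{wt}(T)=\prod_{(i,j)}w(i,j)$ with $w(i,j)=-\alpha_j$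 if $T(i,j)$ is marked; $w(i,j)=\beta_{i-1}$ if $T(i,j)$ is unmarked, $(i-1,j)$ is in the shape and $T(i,j)=T(i-1,j)$ as integers; and $w(i,j)=x_{T(i,j)}$ otherwise. *)

(* Defs.v *)
From HB Require Import structures.
From mathcomp Require Import all_boot all_order all_algebra finmap.
From mathcomp.multinomials Require Import monalg.

Set Implicit Arguments.
Unset Strict Implicit.
Unset Printing Implicit Defensive.

Import GRing.Theory.
Local Open Scope ring_scope.

(* The parameters alpha_1, alpha_2, ... are the left summand, the parameters
   beta_1, beta_2, ... the right one; together with the variables
   x_1, x_2, ... they form the letters.  All indices are shifted:
   [inl i] stands for the letter of index i + 1. *)
Definition param := (nat + nat)%type.
Definition letter := (nat + param)%type.

(* The accessors below restore the usual numbering from 1; they are only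
   meaningful at k >= 1. *)
Definition lx (k : nat) : letter := inl k.-1.
Definition lalpha (k : nat) : letter := inr (inl k.-1).
Definition lbeta (k : nat) : letter := inr (inr k.-1).

(* ZZ[alpha, beta] and ZZ[alpha, beta][x_1, x_2, ...]; in a monomial
   [m : {cmonom nat}], [m i] is the exponent of x_(i + 1). *)
Definition coefring : comNzRingType := {malg int[{cmonom (nat + nat)%type}]}.
Definition xpoly : comNzRingType := {malg coefring[{cmonom nat}]}.

(* ZZ[alpha, beta][[x_1, x_2, ...]] *)
Definition xseries := {cmonom nat} -> coefring.

Definition letter_val (u : letter) : xpoly :=
  match u with
  | inl i => << 1 *g ucm i >>
  | inr p => malgC (<< 1 *g ucm p >> : coefring)
  end.

(* Power series in t over R, as sequences of coefficients. *)
Section TSeries.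
Variable R : comNzRingType.

Definition tone : nat -> R := fun m => (m == 0%N)%:R.
Definition tmul (f g : nat -> R) : nat -> R :=
  fun m => \sum_(i < m.+1) f i * g (m - i)%N.

(* 1 - u t *)
Definition lin (u : R) : nat -> R :=
  fun m => match m with 0 => 1 | 1 => - u | _ => 0 end.
(* 1 / (1 - u t) *)
Definition geom (u : R) : nat -> R := fun m => u ^+ m.

Lemma tmul_lin_geom u : tmul (lin u) (geom u) =1 tone.
Proof.
case=> [|m]; rewrite /tmul /tone.
  by rewrite big_ord1 /= subnn /geom expr0 mulr1.
rewrite !big_ord_recl big1 /= => [|i _]; last by rewrite mul0r.
by rewrite addr0 /geom subn0 subSS subn0 mul1r exprS mulNr subrr.
Qed.

(* (1 - u t) ^ (- c) *)
Definition factor (u : R) (c : int) : nat -> R :=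
  match c with
  | Posz n => iter n (tmul (geom u)) tone
  | Negz n => iter n.+1 (tmul (lin u)) tone
  end.

End TSeries.

(* Formal ZZ-linear combinations of letters. *)
Definition alphabet : zmodType := {malg int[letter]}.

Definition h (m : nat) (Z : alphabet) : xpoly :=
  (\big[@tmul xpoly/@tone xpoly]_(u <- msupp Z)
     factor (letter_val u) (mcoeff u Z)) m.

Definition Asum (k : nat) : alphabet :=
  \sum_(1 <= i < k.+1) << 1 *g lalpha i >>.
Definition Bsum (k : nat) : alphabet :=
  \sum_(1 <= i < k.+1) << 1 *g lbeta i >>.

Definition is_partition (la : seq nat) : bool :=
  sorted geq la && (0%N \notin la).

(* The row index i : 'I_n stands for i + 1, hence the exponents below, and
   truncated predecessors are harmless since A_k = B_k = 0 for k <= 0. *)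
Definition g_num (la : seq nat) (n : nat) : xpoly :=
  \det (\matrix_(i < n, j < n)
          h (nth 0%N la i + n - i.+1)%N
            (<< 1 *g lx j.+1 >> - Asum (nth 0%N la i).-1 + Bsum i)).

Definition g_den (n : nat) : xpoly :=
  \prod_(i < n) \prod_(j < n | (i < j)%N)
    (letter_val (lx i.+1) - letter_val (lx j.+1)).

(* q = g_la(x_1, ..., x_n; alpha, beta); [g_den n] is not a zero divisor. *)
Definition is_g_fin (la : seq nat) (n : nat) (q : xpoly) : Prop :=
  q * g_den n = g_num la n.

(* x_(n + 1) = x_(n + 2) = ... = 0 *)
Definition specialize (n : nat) (G : xseries) : xseries :=
  fun m => if all (fun i => (i < n)%N) (finsupp m) then G m else 0.

Definition is_g (la : seq nat) (G : xseries) : Prop :=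
  forall n, (size la <= n)%N ->
    exists2 q : xpoly, is_g_fin la n q &
      forall m, specialize n G m = mcoeff m q.

(* Cells are numbered from 0; mu = [::] is the empty partition. *)
Definition cell (la mu : seq nat) :=
  {c : 'I_(size la) * 'I_(nth 0%N la 0) | (nth 0%N mu c.1 <= c.2 < nth 0%N la c.1)%N}.

HB.instance Definition _ (la mu : seq nat) := Finite.on (cell la mu).

Section MRPP.
Variables la mu : seq nat.
Notation cell := (cell la mu).

Definition row (c : cell) : nat := (val c).1.
Definition col (c : cell) : nat := (val c).2.

(* d is the right neighbour of c, resp. the neighbour below c. *)
Definition right_of (c d : cell) : bool :=
  (row d == row c) && (col d == (col c).+1).
Definition below (c d : cell) : bool :=
  (row d == (row c).+1) && (col d == col c).

Definition is_rpp (T : {ffun cell -> nat}) : bool :=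
  [&& [forall c, (0 < T c)%N],
      [forall c, forall d, right_of c d ==> (T c <= T d)%N] &
      [forall c, forall d, below c d ==> (T c <= T d)%N]].

(* A filling together with its set of marked cells. *)
Definition marked_filling := ({ffun cell -> nat} * {set cell})%type.

HB.instance Definition _ := Choice.on marked_filling.

Definition is_mrpp (TM : marked_filling) : bool :=
  is_rpp TM.1 &&
  [forall c in TM.2, exists d, right_of c d && (TM.1 c == TM.1 d)].

Definition cell_weight (TM : marked_filling) (c : cell) : xpoly :=
  if c \in TM.2 then - letter_val (lalpha (col c).+1)
  else if [exists d, below d c && (TM.1 c == TM.1 d)]
  then letter_val (lbeta (row c))
  else letter_val (lx (TM.1 c)).

Definition wt (TM : marked_filling) : xpoly := \prod_c cell_weight TM c.

End MRPP.

(* G is the sum of the family F over S: each coefficient receives finitely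
   many nonzero contributions, and is their sum. *)
Definition is_formal_sum (I : choiceType) (S : pred I) (F : I -> xpoly)
    (G : xseries) : Prop :=
  forall m : {cmonom nat}, exists D : {fset I},
    [/\ forall i, i \in D -> S i,
        forall i, S i -> i \notin D -> mcoeff m (F i) = 0
      & G m = \sum_(i <- D) mcoeff m (F i)].

(* Main.v *)
Require Import Defs.
From HB Require Import structures.
From Stdlib Require Import FunctionalExtensionality.
From mathcomp Require Import all_boot all_order all_algebra finmap perm.
From mathcomp.multinomials Require Import monalg.
From mathcomp Require Import zify.

Set Implicit Arguments.
Unset Strict Implicit.
Unset Printing Implicit Defensive.

Import GRing.Theory.
Local Open Scope ring_scope.

(** Dividing the bialternant by the Vandermonde determinant gives the
    Jacobi-Trudi form [det h_(la_i - i + j)[X - A_(la_i - 1) + B_(i - 1)]], which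
    makes sense for any number of variables.  It and the sum over marked reverse
    plane partitions agree without variables, and both satisfy the same branching
    rule when a variable [y] is added: the cells with the largest entry form a
    skew shape [la/mu] whose weight is a product over rows [i] of a factor
    depending on [mu_(i - 1)] and [mu_i] only.

    For the determinant this rule is a statement about wedge products of rows
    (here: alternating functions of sequences of vectors).  Let [W_i(a)] be the
    row of index [i] for [a] with [y] added and the [h] subscripts lowered by 1.
    Expanding one row in powers of [y] gives a sum over all [mu_i <= la_i], without
    interlacing.  The discrepancy with the sum over [mu_i <= mu_(i - 1)], weighted
    with [beta], is a combination of the [W_(i - 1)(k)] with [mu_(i - 1) < k <= la_i]
    whose coefficients do not depend on [mu_(i - 1)]; and for fixed [k] the partial
    sum over [mu_(i - 1) < k] wedged with [W_(i - 1)(k)] vanishes, by induction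
    on [i]. *)

(** * Alternating functions of row sequences *)

Section Slots.
Variables (R : comNzRingType) (V : lmodType R).
Implicit Types (f : nat -> V) (u v : V) (D : (nat -> V) -> R).

Definition upd f i v : nat -> V := fun j => if j == i then v else f j.

Lemma upd_same f i v : upd f i v i = v.
Proof. by rewrite /upd eqxx. Qed.

Lemma upd_other f i j v : j != i -> upd f i v j = f j.
Proof. by rewrite /upd => /negPf ->. Qed.

Lemma updC f i j u v : i != j -> upd (upd f i u) j v = upd (upd f j v) i u.
Proof.
move=> ij; apply: functional_extensionality => k; rewrite /upd.
by case: (eqVneq k j) => [->|//]; rewrite eq_sym (negPf ij).
Qed.

(** Only the slots from [i] to [r.-1] are constrained, because [chain] overwrites the slots below
    [i]. Equality of adjacent slots suffices: only neighbours are ever swapped. *)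
Definition alternating_from (r i : nat) D : Prop :=
  (forall j f a u v, (i <= j < r)%N ->
     D (upd f j (a *: u + v)) = a * D (upd f j u) + D (upd f j v)) /\
  (forall j f, (i <= j)%N -> (j.+1 < r)%N -> f j = f j.+1 -> D f = 0).

Section Alternating.
Variables (r i : nat) (D : (nat -> V) -> R).
Hypothesis altD : alternating_from r i D.

Lemma alternating_lincomb j f (I : Type) (s : seq I) (P : pred I)
    (a : I -> R) (F : I -> V) :
  (i <= j < r)%N ->
  D (upd f j (\sum_(k <- s | P k) a k *: F k))
    = \sum_(k <- s | P k) a k * D (upd f j (F k)).
Proof.
move=> jr; have D0 : D (upd f j 0) = 0.
  (* With coefficient -1 and both vectors zero, linearity expresses the value at 0 as the sum of a
     term and its opposite. *)
  have := altD.1 j f (-1) 0 0 jr.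
  by rewrite scaler0 addr0 mulN1r addNr.
elim: s => [|k s IH]; first by rewrite !big_nil.
rewrite !big_cons; case: (P k) => //.
by rewrite altD.1 // IH.
Qed.

Lemma alternatingZ j f a u : (i <= j < r)%N ->
  D (upd f j (a *: u)) = a * D (upd f j u).
Proof.
move=> jr; have := alternating_lincomb f [:: tt] xpredT (fun=> a) (fun=> u) jr.
by rewrite !big_seq1.
Qed.

Lemma alternatingB j f u v : (i <= j < r)%N ->
  D (upd f j (u - v)) = D (upd f j u) - D (upd f j v).
Proof.
by move=> jr; rewrite addrC -scaleN1r altD.1 // mulN1r addrC.
Qed.

Lemma alternating_swap j f u v : (i <= j)%N -> (j.+1 < r)%N ->
  D (upd (upd f j u) j.+1 v) = - D (upd (upd f j v) j.+1 u).
Proof.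
move=> ij jr; have jr' : (i <= j.+1 < r)%N by rewrite jr leqW.
have jr0 : (i <= j < r)%N by rewrite ij ltnW.
have ne : j != j.+1 by rewrite neq_ltn ltnSn.
have same w : D (upd (upd f j w) j.+1 w) = 0.
  by apply: altD.2 ij jr _; rewrite upd_same upd_other // upd_same.
apply/eqP; rewrite -addr_eq0; apply/eqP.
have := same (1 *: u + v).
rewrite altD.1 // ![upd (upd f j (_ + _)) _ _]updC // !altD.1 // !mul1r.
by rewrite -![upd (upd f j.+1 _) _ _]updC // !same add0r addr0 addrC.
Qed.

End Alternating.

End Slots.

(** * Branching of alternating functions *)

Section Branching.
Variables (R : comNzRingType) (V : lmodType R) (r K : nat).
Variables (y : R) (al b : nat -> R) (la : nat -> nat).

(** Total weight, marked or not, of cell [j] (counted from 1) of row [i] in the strip [la/mu]. A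
    mark needs a right neighbour in the strip; without a mark the weight is [y] if the cell above
    lies in [mu], whose row there has length [p], and [b i] if that cell lies in the strip too. *)
Definition step_factor i p j : R :=
  (if (j < la i)%N then - al j else 0) + (if (j <= p)%N then y else b i).

Definition step i p q : R :=
  if (q <= p)%N && (q <= la i)%N
  then \prod_(q.+1 <= j < (la i).+1) step_factor i p j else 0.

(** [Q] and [P] are the rows before and after [y] is added. The index of [W] is one ahead: [W i.+1]
    is row [i] with [y] added and the subscripts lowered. *)
Variables (Q P W : nat -> nat -> V).
Hypothesis W0 : forall i, (i < r)%N -> W i.+1 0%N = 0.
Hypothesis WS : forall i a, (i < r)%N ->
  W i.+1 a.+1 = Q i a + (y - al a) *: W i.+1 a.
Hypothesis PQ : forall i a, (i < r)%N -> P i a = Q i a + y *: W i.+1 a.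
Hypothesis PW : forall i a, (i < r)%N -> P i a = b i *: W i.+1 a + W i a.
Hypothesis la_dec : forall i, (i.+1 < r)%N -> (la i.+1 <= la i)%N.
Hypothesis la_lt : forall i, (i < r)%N -> (la i < K)%N.

(** Eliminating [Q] and [P] also eliminates [y]: this is the recursion for the columns where
    [step_factor] takes [b i]. *)
Lemma W_rec i a : (i < r)%N -> W i.+1 a.+1 = (b i - al a) *: W i.+1 a + W i a.
Proof.
move=> ir; have e : Q i a = b i *: W i.+1 a + W i a - y *: W i.+1 a.
  by rewrite -PW // PQ // addrK.
by rewrite WS // e !scalerBl addrA subrK addrAC.
Qed.

(** Below [p.+1] and [la i] the factor of column [k] is [y - al k], the coefficient in [WS], so each
    new term merges with the multiple of [W i.+1 k] obtained so far. *)
Lemma step_sum_low i p k : (i < r)%N -> (k <= p.+1)%N -> (k <= la i)%N ->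
  \sum_(0 <= q < k) step i p q *: Q i q
    = (\prod_(k <= j < (la i).+1) step_factor i p j) *: W i.+1 k.
Proof.
move=> ir; elim: k => [|k IH] kp kl.
  by rewrite (big_geq (m := 0%N) (n := 0%N)) // W0 // scaler0.
rewrite big_nat_recr //= IH ?(ltnW kp) ?(ltnW kl) //.
rewrite /step -ltnS kp (ltnW kl) /= [X in X *: W _ _]big_ltn ?ltnS 1?ltnW //.
rewrite {1}/step_factor kl -ltnS kp mulrC -scalerA -scalerDr; congr (_ *: _).
by rewrite WS // addrC (addrC y).
Qed.

Definition stepped i p : V := \sum_(0 <= q < K) step i p q *: Q i q.

Lemma step_sum_cut i p k : (p < k)%N -> (k <= K)%N ->
  \sum_(0 <= q < k) step i p q *: Q i q = stepped i p.
Proof.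
move=> pk kK; rewrite /stepped [RHS](big_cat_nat (n := k)) //=.
rewrite [X in _ = _ + X]big_nat_cond.
rewrite [X in _ = _ + X]big1 ?addr0 // => q /andP[/andP[kq _] _]; rewrite /step.
by rewrite leqNgt (leq_trans pk kq) scale0r.
Qed.

Lemma stepped_high i p : (i < r)%N -> (la i <= p)%N -> stepped i p = P i (la i).
Proof.
move=> ir lp; rewrite /stepped (big_cat_nat (n := (la i).+1)) ?la_lt //=.
rewrite [X in _ + X]big_nat_cond [X in _ + X]big1 => [|q /andP[/andP[lq _] _]].
  rewrite addr0 big_nat_recr //= step_sum_low ?leqW // big_nat1 /step lp leqnn.
  by rewrite /= big_geq // scale1r /step_factor ltnn lp add0r PQ // addrC.
by rewrite /step [(q <= la i)%N]leqNgt lq andbF scale0r.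
Qed.

(** The product of the factors of the columns beyond [k], all of type [b i]. It depends neither on
    [p] nor on [y], which allows the sum over [p] to be done first. *)
Definition low_coef i k : R :=
  \prod_(k.+1 <= j < (la i).+1) ((if (j < la i)%N then - al j else 0) + b i).

Lemma stepped_low i p : (i < r)%N -> (p < la i)%N ->
  stepped i p = P i (la i) - \sum_(p.+1 <= k < (la i).+1) low_coef i k *: W i k.
Proof.
move=> ir pl; rewrite -(@step_sum_cut i p p.+1) //; last first.
  exact: leq_trans pl (ltnW (la_lt ir)).
have top : low_coef i (la i) = 1 by rewrite /low_coef big_geq.
rewrite step_sum_low // PW // [X in _ - X]big_nat_recr //= top scale1r.
rewrite opprD addrA addrAC addrK.
(* By [W_rec] the terms of the sum are differences of [F]. The last column carries no [al], so
   [F (la i)] is [b i *: W i.+1 (la i)], the other half of [P i (la i)]. *)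
pose F k := low_coef i k.-1 *: W i.+1 k.
have FS k : (p.+1 <= k < la i)%N -> low_coef i k *: W i k = F k.+1 - F k.
  case/andP=> pk kl; rewrite /F /= W_rec // scalerDr addrAC.
  suff -> : low_coef i k.-1 = low_coef i k * (b i - al k).
    by rewrite scalerA subrr add0r.
  have k0 : (0 < k)%N by apply: leq_trans pk.
  have ks : (k < (la i).+1)%N by apply: leqW.
  by rewrite /low_coef prednK // (big_ltn ks) kl mulrC (addrC (b i)).
rewrite (eq_big_nat _ _ FS) telescope_sumr // /F opprB /=.
suff -> : low_coef i (la i).-1 = b i.
  rewrite addrC subrK; congr (_ *: _); apply: eq_big_nat => j /andP[pj _].
  by rewrite /step_factor (leqNgt j p) pj.
have l0 : (0 < la i)%N by apply: leq_trans pl.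
by rewrite /low_coef prednK // big_nat1 ltnn add0r.
Qed.

(** Uniform form of the two cases: [p] is left in the range of summation only. *)
Lemma steppedE i p : (i < r)%N ->
  stepped i p = P i (la i)
    - \sum_(0 <= k < K | (p < k <= la i)%N) low_coef i k *: W i k.
Proof.
move=> ir; have [lp|pl] := leqP (la i) p.
  rewrite stepped_high // big1 ?subr0 // => k /andP[pk kl].
  by have := leq_ltn_trans lp (leq_trans pk kl); rewrite ltnn.
rewrite stepped_low //; congr (_ - _).
by rewrite (big_nat_widenl _ 0) // (big_nat_widen _ _ K) ?ltnS ?la_lt //.
Qed.

Definition unroll_coef i k j : R := \prod_(j.+1 <= l < k) (b i - al l).

(** Iterating [W_rec] from [k] down to [p.+1]. The coefficient [c] stays anonymous, since its term
    is later killed by alternation; the others do not depend on [p]. *)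
Lemma W_unroll i p k : (i < r)%N -> (p < k)%N -> (k <= K)%N ->
  exists c, W i.+1 k = c *: W i.+1 p.+1
    + \sum_(0 <= j < K | (p < j < k)%N) unroll_coef i k j *: W i j.
Proof.
move=> ir pk kK.
have [c e] : exists c, W i.+1 k = c *: W i.+1 p.+1
    + \sum_(p.+1 <= j < k) unroll_coef i k j *: W i j.
  elim: k pk {kK} => // k IH; rewrite ltnS leq_eqVlt => /orP[/eqP <-|pk].
    by exists 1; rewrite scale1r [X in _ + X]big_geq // addr0.
  have [c e] := IH pk; exists ((b i - al k) * c).
  rewrite W_rec // e scalerDr scalerA -addrA; congr (_ + _).
  rewrite [RHS]big_nat_recr //= scaler_sumr.
  have top : unroll_coef i k.+1 k = 1 by rewrite /unroll_coef big_geq.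
  rewrite top scale1r; congr (_ + _); apply: eq_big_nat => j /andP[_ jk].
  by rewrite scalerA /unroll_coef big_nat_recr //= mulrC.
by exists c; rewrite e (big_nat_widenl _ 0) // (big_nat_widen _ _ K).
Qed.

Variable D : (nat -> V) -> R.
Hypothesis altD : alternating_from r 0 D.
Hypothesis K_gt0 : (0 < K)%N.

(* The weighted sum of [D (Q 0 q_0) .. (Q i.-1 q_(i - 1)) (f i) (f i.+1) ..] over the
   [q_0, .., q_(i - 1)] with [q_(i - 1) = q]; the row above the first one has the
   fictitious length [K.-1]. *)
Fixpoint chain i q (f : nat -> V) : R :=
  if i is i'.+1
  then \sum_(0 <= p < K) step i' p q * chain i' p (upd f i' (Q i' q))
  else if q == K.-1 then D f else 0.

Lemma chainS i q f :
  chain i.+1 q f = \sum_(0 <= p < K) step i p q * chain i p (upd f i (Q i q)).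
Proof. by []. Qed.

Lemma alternating_chain i q : (i <= r)%N -> alternating_from r i (chain i q).
Proof.
elim: i q => [|i IH] q ir /=.
  by case: eqP => // _; split=> *; rewrite ?mulr0 ?addr0.
have alt p := IH p (ltnW ir); split=> [j f a u v /andP[ij jr]|j f ij jr e].
  rewrite mulr_sumr -big_split; apply: eq_bigr => p _ /=.
  have ne : j != i by rewrite neq_ltn ij orbT.
  by rewrite !(updC _ _ _ ne) (alt p).1 ?(ltnW ij) // mulrDr mulrCA.
rewrite big1 // => p _; rewrite ((alt p).2 j) ?mulr0 ?(ltnW ij) //.
by rewrite !upd_other ?e // neq_ltn ?ij ?leqW // orbT.
Qed.

Definition cap i : nat := if i is i'.+1 then la i' else K.-1.

Lemma la_le_cap i : (i < r)%N -> (la i <= cap i)%N.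
Proof.
by case: i => [|i] ir /=; [rewrite -ltnS prednK // la_lt | apply: la_dec].
Qed.

(** Induction on [i]. The contents of slots [i] and [i.+1] are expanded into [P i (la i)] and rows
    [W i j], with coefficients free of [p]; for each choice of rows the sum over [p] is an instance
    of the statement for [i], up to a swap. *)
Lemma chain_vanish i k f : (i < r)%N -> (k <= cap i)%N ->
  \sum_(0 <= q < K | (q < k)%N) chain i q (upd f i (W i k)) = 0.
Proof.
elim: i k f => [|i IH] k f ir kc.
  (* [chain 0 q] is nonzero at [q = K.-1] only, while [q < k <= K.-1]. *)
  rewrite big1 // => q qk /=; case: eqP => // e.
  by move: kc; rewrite /= -e leqNgt qk.
have ir' := ltnW ir; have alt p := alternating_chain p (ltnW ir').
have ii : (i <= i < r)%N by rewrite leqnn.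
have ii1 : (i <= i.+1 < r)%N by rewrite leqnSn.
have ne : i != i.+1 by rewrite neq_ltn ltnSn.
have ne' : i.+1 != i by rewrite eq_sym.
have kK : (k <= K)%N by apply: leq_trans kc (ltnW (la_lt ir')).
pose A p j := chain i p (upd (upd f i (P i (la i))) i.+1 (W i j)).
pose B p j l := chain i p (upd (upd f i (W i l)) i.+1 (W i j)).
(* A swap brings [W i j] to slot [i], where the induction hypothesis applies. *)
have A0 j : (j <= la i)%N -> \sum_(0 <= p < K | (p < j)%N) A p j = 0.
  move=> jl; under eq_bigr do rewrite /A (alternating_swap (alt _)) // updC //.
  by rewrite sumrN IH ?oppr0 // (leq_trans jl) ?la_le_cap.
(* Here [p] runs below the smaller of [j] and [l]; the induction hypothesis is applied to the row of
   that index, swapped into slot [i] if necessary. *)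
have B0 j l : (j <= la i)%N -> (l <= la i)%N ->
    \sum_(0 <= p < K | (p < j)%N && (p < l)%N) B p j l = 0.
  move=> jl ll; have [jl'|lj] := leqP j l.
    rewrite (eq_bigl (fun p => p < j)%N) => [|p]; last first.
      by case pj: (p < j)%N; rewrite //= (leq_trans pj).
    under eq_bigr do rewrite /B (alternating_swap (alt _)) // updC //.
    by rewrite sumrN IH ?oppr0 // (leq_trans jl) ?la_le_cap.
  rewrite (eq_bigl (fun p => p < l)%N) => [|p]; last first.
    by case pl: (p < l)%N; rewrite ?andbF // andbT (ltn_trans pl).
  under eq_bigr do rewrite /B updC //.
  by rewrite IH // (leq_trans ll) ?la_le_cap.
pose g := upd f i.+1 (W i.+1 k).
have -> : \sum_(0 <= q < K | (q < k)%N) chain i.+1 q g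
    = \sum_(0 <= p < K) chain i p (upd g i (\sum_(0 <= q < k) step i p q *: Q i q)).
  under eq_bigr do rewrite chainS.
  rewrite exchange_big; apply: eq_bigr => p _.
  rewrite (alternating_lincomb (alt p)) //.
  by rewrite [RHS](big_nat_widen _ _ K).
(* If [k <= p.+1], slot [i] holds a multiple of [W i.+1 k], which is also the content of slot
   [i.+1], so the term vanishes. *)
rewrite (bigID (fun p => p.+1 < k)%N) /= [X in _ + X]big1 ?addr0; last first.
  move=> p; rewrite -leqNgt => kp; rewrite step_sum_low //.
  rewrite (alternatingZ (alt p)) // ((alt p).2 i) ?mulr0 //.
  by rewrite upd_same upd_other // /g upd_same.
pose d := unroll_coef i k.
transitivity (\sum_(0 <= p < K | (p.+1 < k)%N)
    \sum_(0 <= j < K | (p < j < k)%N) d j * (A p j -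
      \sum_(0 <= l < K | (p < l <= la i)%N) low_coef i l * B p j l)).
  apply: eq_bigr => p pk; rewrite (step_sum_cut _ (ltnW pk) kK).
  have [c e] := W_unroll ir' (ltnW pk) kK.
  have pl : (p < la i)%N by apply: leq_trans (ltnW pk) kc.
  rewrite /g -updC // e (alt p).1 //.
  (* In the term with coefficient [c], [stepped i p] is written as a multiple of [W i.+1 p.+1], the
     row in the next slot. *)
  rewrite -{1}(@step_sum_cut i p p.+1) //; last by apply: leq_trans (ltnW pk) kK.
  rewrite step_sum_low // updC // (alternatingZ (alt p)) //.
  rewrite ((alt p).2 i) ?mulr0 ?add0r //; last first.
    by rewrite upd_same upd_other // upd_same.
  rewrite (alternating_lincomb (alt p)) //; apply: eq_bigr => j _; congr (_ * _).
  rewrite updC // steppedE // (alternatingB (alt p)) // -updC //; congr (_ - _).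
  rewrite (alternating_lincomb (alt p)) //; apply: eq_bigr => l _.
  by rewrite updC.
(* The coefficients are free of [p], so the sum over [p] moves inside, where [A0] and [B0] apply. *)
rewrite (exchange_big_dep (fun j => j < k)%N) /=; last by move=> p j _ /andP[].
rewrite big1 // => j jk; have jl := leq_trans (ltnW jk) kc.
rewrite -mulr_sumr (eq_bigl (fun p => p < j)%N) => [|p]; last first.
  by rewrite jk andbT; case pj: (p < j)%N; rewrite ?andbF // (leq_ltn_trans pj).
rewrite sumrB A0 // sub0r.
rewrite (exchange_big_dep (fun l => l <= la i)%N) /=; last by move=> p l _ /andP[].
rewrite big1 ?oppr0 ?mulr0 // => l ll; rewrite -mulr_sumr.
rewrite (eq_bigl (fun p => (p < j) && (p < l))%N) ?B0 ?mulr0 // => p.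
by rewrite ll andbT.
Qed.

(** By [steppedE], slot [i] receives [P i (la i)] minus multiples of the [W i k]. For fixed [k] the
    correction is a sum over [p < k], zero by [chain_vanish]. *)
Lemma sum_chain i f : (i <= r)%N ->
  \sum_(0 <= q < K) chain i q f
    = D (fun j => if (j < i)%N then P j (la j) else f j).
Proof.
elim: i f => [|i IH] f ir.
  rewrite -{1}(prednK K_gt0) big_nat_recr //= eqxx big_nat big1 ?add0r //.
  by move=> q qK; rewrite ltn_eqF.
have alt p := alternating_chain p (ltnW ir).
have ii : (i <= i < r)%N by rewrite leqnn.
transitivity (\sum_(0 <= p < K) chain i p (upd f i (stepped i p))).
  under eq_bigr do rewrite chainS.
  rewrite exchange_big; apply: eq_bigr => p _.
  by rewrite (alternating_lincomb (alt p)).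
under eq_bigr => p _.
  rewrite steppedE // (alternatingB (alt p)) //.
  rewrite (alternating_lincomb (alt p)) //.
over.
rewrite sumrB IH 1?ltnW // (exchange_big_dep (fun k => k <= la i)%N) /=; last first.
  by move=> p k _ /andP[].
rewrite [X in _ - X]big1 ?subr0 => [|k kl].
  congr D; apply: functional_extensionality => j; rewrite (ltnS j) (leq_eqVlt j) /upd.
  by case: (eqVneq j i) => [->|_] /=; rewrite ?ltnn.
rewrite -mulr_sumr (eq_bigl (fun p => p < k)%N) => [|p]; last by rewrite kl andbT.
by rewrite chain_vanish ?mulr0 // (leq_trans kl) // la_le_cap.
Qed.

Fixpoint words i : seq (seq nat) :=
  if i is i'.+1
  then [seq rcons s q | s <- words i', q <- index_iota 0 K] else [:: [::]].

Lemma mem_words i s :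
  (s \in words i) = (size s == i) && all (fun q => q < K)%N s.
Proof.
elim: i s => [|i IH] s /=; first by rewrite inE -size_eq0; case: s.
apply/allpairsP/idP => [[[t q] /= [ht hq ->]]|].
  move: ht hq; rewrite IH mem_index_iota size_rcons eqSS all_rcons.
  by move=> /andP[-> ->] /= ->.
case/lastP: s => // s q; rewrite size_rcons eqSS all_rcons => /and3P[hs hq ha].
by exists (s, q); rewrite IH hs ha mem_index_iota hq.
Qed.

Lemma words_uniq i : uniq (words i).
Proof.
elim: i => //= i IH; apply: allpairs_uniq; rewrite ?iota_uniq // => -[s q] [t p] _ _.
by move=> /= /rcons_inj[-> ->].
Qed.

Definition weight (s : seq nat) : R :=
  \prod_(0 <= i < size s) step i (nth 0%N (K.-1 :: s) i) (nth 0%N s i).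

(** The arbitrary factor [c] makes the induction go through: it is instantiated with the next
    [step], which depends on the last entry of the word. *)
Lemma chain_words i (c : nat -> R) f :
  \sum_(0 <= q < K) c q * chain i q f =
  \sum_(s <- words i) c (last K.-1 s) * (weight s *
     D (fun j => if (j < i)%N then Q j (nth 0%N s j) else f j)).
Proof.
elim: i c f => [|i IH] c f.
  rewrite -{1}(prednK K_gt0) big_nat_recr //= eqxx big_nat big1 ?add0r //.
    rewrite big_seq1 /weight big_geq //= mul1r //.
  by move=> q qK; rewrite ltn_eqF // mulr0.
under eq_bigr => q _.
  rewrite chainS IH mulr_sumr.
over.
rewrite exchange_big /= big_allpairs_dep /= big_seq [RHS]big_seq.
apply: eq_bigr => s; rewrite mem_words => /andP[/eqP ss _].
apply: eq_bigr => q _; rewrite last_rcons; congr (_ * _).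
rewrite /weight size_rcons big_nat_recr //= ss nth_rcons ss ltnn eqxx.
rewrite -rcons_cons nth_rcons /= ss ltnSn (_ : nth _ _ i = last K.-1 s); last first.
  by rewrite -ss nth_last.
rewrite mulrA; congr (_ * D _).
  rewrite mulrC; congr (_ * _); apply: eq_big_nat => j /andP[_ ji].
  by rewrite -rcons_cons !nth_rcons /= ss ji ltnW.
apply: functional_extensionality => j; rewrite (ltnS j) (leq_eqVlt j) /upd nth_rcons ss.
by case: (eqVneq j i) => [->|_] /=; rewrite ?ltnn //; case: ifP.
Qed.

Lemma branching f :
  D (fun j => if (j < r)%N then P j (la j) else f j)
    = \sum_(s <- words r) weight s *
        D (fun j => if (j < r)%N then Q j (nth 0%N s j) else f j).
Proof.
rewrite -sum_chain //; have := chain_words r (fun=> 1) f.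
by under eq_bigr do rewrite mul1r; move=> ->; under eq_bigr do rewrite mul1r.
Qed.

End Branching.

(** * Power series in t *)

Section SeriesInT.
Variable R : comNzRingType.
Implicit Types f g k : nat -> R.

Lemma tmulC : commutative (@tmul R).
Proof.
move=> f g; apply: functional_extensionality => m; rewrite /tmul.
rewrite (reindex_inj rev_ord_inj) /=; apply: eq_bigr => i _.
by rewrite subSS subKn 1?mulrC // -ltnS.
Qed.

Lemma tmul1 : left_id (@tone R) (@tmul R).
Proof.
move=> f; apply: functional_extensionality => m; rewrite /tmul big_ord_recl.
rewrite big1 => [|i _]; last by rewrite /tone mul0r.
by rewrite /tone mul1r subn0 addr0.
Qed.

Lemma tmulA : associative (@tmul R).
Proof.
move=> f g k; apply: functional_extensionality => m.
rewrite /tmul.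
under eq_bigr => i _ do rewrite mulr_sumr.
under [RHS]eq_bigr => i _ do rewrite mulr_suml.
(* Both sides become sums over a full square with the condition [i + j <= m], so that the order of
   summation can be exchanged. *)
pose F (i j : nat) := f i * g j * k (m - (i + j))%N.
transitivity (\sum_(0 <= i < m.+1) \sum_(0 <= j < m.+1 | (i + j <= m)%N) F i j).
  rewrite big_mkord; apply: eq_bigr => i _; rewrite big_mkord.
  have im : (i <= m)%N by rewrite -ltnS.
  rewrite (big_ord_widen_cond m.+1 xpredT (fun j => f i * (g j * k (m - i - j)%N)));
    last by rewrite ltnS leq_subr.
  apply: eq_big => [j|j _] /=; first by rewrite ltnS leq_subRL.
  by rewrite /F mulrA subnDA.
under [RHS]eq_bigr => i _.
  rewrite (big_ord_widen_cond m.+1 xpredT (fun j => f j * g (i - j)%N * k (m - i)%N));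
    last by rewrite ltn_ord.
over.
rewrite [RHS](exchange_big_dep xpredT) //= big_mkord; apply: eq_bigr => i _.
have im : (i <= m.+1)%N by rewrite ltnW.
transitivity (\sum_(i <= j < m.+1) f i * g (j - i)%N * k (m - j)%N); last first.
  by rewrite (big_nat_widenl _ 0) // big_mkord; apply: eq_bigl => j; rewrite ltnS.
rewrite -{1}[in RHS](add0n (val i)) big_addn.
rewrite [RHS](big_nat_widen _ _ m.+1) ?leq_subr //.
apply: congr_big_nat => // j /andP[_ jm].
  by rewrite ltn_subRL ltnS.
by rewrite /F addnK (addnC j).
Qed.

HB.instance Definition _ :=
  Monoid.isComLaw.Build (nat -> R) (@tone R) (@tmul R) tmulA tmulC tmul1.

Lemma tmul_geom_lin (u : R) : tmul (geom u) (lin u) = @tone R.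
Proof. by rewrite tmulC; apply: functional_extensionality => m; apply: tmul_lin_geom. Qed.

Lemma factorD1 (u : R) (c : int) : factor u (c + 1) = tmul (geom u) (factor u c).
Proof.
case: c => [n|n]; first by rewrite -PoszD addn1.
have -> : factor u (Negz n) = tmul (lin u) (iter n (tmul (lin u)) (@tone R)) by [].
rewrite tmulA tmul_geom_lin tmul1.
case: n => [|n]; first by [].
by rewrite (_ : Negz n.+1 + 1 = Negz n) // !NegzE; lia.
Qed.

Lemma factorB1 (u : R) (c : int) : factor u (c - 1) = tmul (lin u) (factor u c).
Proof.
by rewrite -{2}(subrK 1 c) factorD1 tmulA (tmulC (lin u)) tmul_geom_lin tmul1.
Qed.

Lemma factorD (u : R) (c d : int) :
  factor u (c + d) = tmul (factor u c) (factor u d).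
Proof.
elim/int_rec: c => [|n IH|n IH]; first by rewrite add0r tmul1.
  by rewrite -addn1 PoszD addrAC !factorD1 IH tmulA.
by rewrite -addn1 PoszD opprD addrAC !factorB1 IH tmulA.
Qed.

End SeriesInT.

Definition hseries (Z : alphabet) : nat -> xpoly :=
  \big[@tmul xpoly/@tone xpoly]_(u <- msupp Z) factor (letter_val u) (mcoeff u Z).

Lemma hseriesEw (d : {fset letter}) (Z : alphabet) : (msupp Z `<=` d)%fset ->
  hseries Z = \big[@tmul xpoly/@tone xpoly]_(u <- d) factor (letter_val u) (mcoeff u Z).
Proof.
move=> sub; rewrite /hseries (big_fset_incl _ sub) // => u _ uZ.
by rewrite mcoeff_outdom.
Qed.

Lemma hseriesD (Y Z : alphabet) : hseries (Y + Z) = tmul (hseries Y) (hseries Z).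
Proof.
rewrite (hseriesEw (msuppD_le Y Z)) (hseriesEw (fsubsetUl (msupp Y) (msupp Z))).
rewrite (hseriesEw (fsubsetUr (msupp Y) (msupp Z))) -big_split /=.
by apply: eq_bigr => u _; rewrite mcoeffD factorD.
Qed.

Lemma hseries0 : hseries 0 = @tone xpoly.
Proof. by rewrite /hseries msupp0 big_seq_fset0. Qed.

Lemma hseries_letter (u : letter) (c : int) : hseries << c *g u >> = factor (letter_val u) c.
Proof.
rewrite (hseriesEw msuppU_le) big_seq_fset1 mcoeffUU //.
Qed.

(** * The Jacobi-Trudi form of the bialternant *)

Lemma tmul_at0 (R : comNzRingType) (f g : nat -> R) : tmul f g 0%N = f 0%N * g 0%N.
Proof. by rewrite /tmul big_ord1. Qed.

Lemma tmul_linS (R : comNzRingType) (u : R) f m :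
  tmul (lin u) f m.+1 = f m.+1 - u * f m.
Proof.
rewrite /tmul 2!big_ord_recl big1 => [|i _]; last by rewrite /= mul0r.
by rewrite addr0 /= subn0 subSS subn0 mul1r mulNr.
Qed.

Lemma tmul_trunc (R : comNzRingType) (f g : nat -> R) n m :
  (forall k, (n <= k)%N -> f k = 0) ->
  tmul f g m = \sum_(k < n) (if (k <= m)%N then g (m - k)%N else 0) * f k.
Proof.
move=> f0; rewrite /tmul.
transitivity (\sum_(k < n + m.+1) (if (k <= m)%N then g (m - k)%N else 0) * f k).
  rewrite (big_ord_widen (n + m.+1) (fun k => f k * g (m - k)%N)) ?leq_addl //.
  rewrite big_mkcond /=; apply: eq_bigr => k _.
  by rewrite ltnS; case: ifP => _; rewrite ?mul0r // mulrC.
rewrite big_split_ord /= [X in _ + X]big1 ?addr0 // => k _.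
by rewrite f0 ?mulr0 // leq_addr.
Qed.

Lemma factor_at0 (R : comNzRingType) (u : R) (c : int) : factor u c 0%N = 1.
Proof.
case: c => n; rewrite /factor; last rewrite iterS tmul_at0 mul1r.
  by elim: n => [|n IH] //; rewrite iterS tmul_at0 IH mulr1.
by elim: n => [|n IH] //; rewrite iterS tmul_at0 IH mulr1.
Qed.

Lemma h_at0 Z : h 0 Z = 1.
Proof.
rewrite /h; elim/big_ind: _ => [|f g ef eg|u _]; first by [].
  by rewrite tmul_at0 ef eg mulr1.
exact: factor_at0.
Qed.

(** Compares coefficients in (1 - ut) H[Z + u] = H[Z], where H is the generating series of the
    [h]. *)
Lemma hD_letter m u Z :
  h m.+1 (Z + << 1 *g u >>) = h m.+1 Z + letter_val u * h m (Z + << 1 *g u >>).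
Proof.
have e : hseries Z = tmul (lin (letter_val u)) (hseries (Z + << 1 *g u >>)).
  by rewrite -{1}(addrK << 1 *g u >> Z) -monalgUN hseriesD hseries_letter tmulC
    /= [tmul _ (tone _)]tmulC tmul1.
by rewrite -[h m.+1 Z]/(hseries Z m.+1) e tmul_linS subrK.
Qed.

(* [h_{m - s}], with the convention [h_k = 0] for [k < 0]. *)
Definition hshift (s m : nat) (Z : alphabet) : xpoly :=
  if (s <= m)%N then h (m - s) Z else 0.

Lemma hshiftD s m u Z :
  hshift s m (Z + << 1 *g u >>)
    = hshift s m Z + letter_val u * hshift s.+1 m (Z + << 1 *g u >>).
Proof.
rewrite /hshift; case: (ltngtP s m) => [sm|_|->]; rewrite ?mulr0 ?addr0 //.
  by rewrite -(prednK (_ : 0 < m - s)%N) ?subn_gt0 // hD_letter subnS.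
by rewrite subnn !h_at0.
Qed.

Lemma hshiftB s m u Z :
  hshift s m (Z - << 1 *g u >>)
    = hshift s m Z - letter_val u * hshift s.+1 m Z.
Proof. by apply/eqP; rewrite eq_sym subr_eq -{1 3}(subrK << 1 *g u >> Z) hshiftD. Qed.

Lemma hshiftSS s m Z : hshift s.+1 m.+1 Z = hshift s m Z.
Proof. by rewrite /hshift ltnS subSS. Qed.

(** The generating series is the product of the 1 - ut, a polynomial of degree at most [size us]. *)
Lemma hB_eq0 (us : seq letter) m :
  (size us < m)%N -> h m (- \sum_(u <- us) << 1 *g u >>) = 0.
Proof.
elim: us m => [|u us IH] [//|m] /= us_m.
  by rewrite big_nil oppr0 -[h _ _]/(hseries 0 m.+1) hseries0.
have := hshiftB 0 m.+1 u (- \sum_(v <- us) << 1 *g v >>).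
rewrite /hshift !subn0 subSS subn0 /= big_cons opprD addrC => ->.
by rewrite !IH ?mulr0 ?subr0 // ltnW.
Qed.

Lemma h_letter m u : h m << 1 *g u >> = letter_val u ^+ m.
Proof.
rewrite -[h m _]/(hseries _ m) hseries_letter /=.
by rewrite [tmul _ _]tmulC tmul1.
Qed.

Lemma hD_trunc n m Y Z : (forall k, (n <= k)%N -> h k Y = 0) ->
  h m (Y + Z) = \sum_(k < n) hshift k m Z * h k Y.
Proof.
move=> Y0; rewrite -[h m _]/(hseries _ m) hseriesD.
exact: (tmul_trunc (hseries Z) m Y0).
Qed.

Definition xsum (n : nat) : alphabet := \sum_(i < n) << 1 *g lx i.+1 >>.

Lemma xsumS n : xsum n.+1 = xsum n + << 1 *g lx n.+1 >>.
Proof. by rewrite /xsum big_ord_recr. Qed.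

Lemma hB_xsum_eq0 n (j : 'I_n) k :
  (n <= k)%N -> h k (<< 1 *g lx j.+1 >> - xsum n) = 0.
Proof.
move=> nk; rewrite /xsum (bigD1 j) //= opprD addNKr.
rewrite -big_filter -(big_map (fun i : 'I_n => lx i.+1) xpredT (fun u => << 1 *g u >>)).
rewrite hB_eq0 // size_map size_filter; apply: leq_trans nk.
have := cardC1 j; rewrite cardE /= size_filter card_ord => ->.
by rewrite prednK //; apply: leq_ltn_trans (ltn_ord j).
Qed.

Section Bialternant.
Variable n : nat.

(** Up to sign, the entries are the elementary symmetric polynomials in the variables other than
    [lx j.+1]. *)
Definition xdiff_mx : 'M[xpoly]_n :=
  \matrix_(k, j) h (n - k.+1) (<< 1 *g lx j.+1 >> - xsum n).

(** With X the sum of the variables, x_j + Z is split as (x_j - X) + (X + Z). The first part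
    involves [n.-1] letters, negatively, so the convolution has [n] terms and is a matrix
    product. *)
Lemma bialternant_mx (m : 'I_n -> nat) (Z : 'I_n -> alphabet) :
  \matrix_(i, j) h (m i) (<< 1 *g lx j.+1 >> + Z i) =
  (\matrix_(i, k) hshift (n - k.+1) (m i) (xsum n + Z i)) *m xdiff_mx.
Proof.
apply/matrixP => i j; rewrite !mxE.
have -> : << 1 *g lx j.+1 >> + Z i = << 1 *g lx j.+1 >> - xsum n + (xsum n + Z i).
  by rewrite addrA subrK.
rewrite (hD_trunc (m i) (xsum n + Z i) (@hB_xsum_eq0 n j)).
rewrite [LHS](reindex_inj (@rev_ord_inj n)).
apply: eq_bigr => k _.
by rewrite !mxE.
Qed.

(** The factorization is applied to the exponents [n - i.+1] and [Z = 0]: the left side is then a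
    Vandermonde matrix and the first factor is unitriangular. *)
Lemma det_xdiff_mx : \det xdiff_mx = g_den n.
Proof.
have := bialternant_mx (fun i => n - i.+1)%N (fun=> 0).
set U := (\matrix_(i, k) hshift _ _ _) => /(congr1 determinant).
rewrite det_mulmx.
have -> : \det U = 1.
  rewrite -det_tr det_trig; last first.
    apply/is_trig_mxP => i j ij; rewrite !mxE /hshift leqNgt.
    by rewrite (_ : (_ < _)%N = true) //; have := ltn_ord j; lia.
  by rewrite big1 // => i _; rewrite !mxE /hshift leqnn subnn h_at0.
rewrite mul1r => <-.
pose x : 'rV[xpoly]_n := \row_j letter_val (lx (rev_ord j).+1).
(* Reversing both rows and columns gives the same sign twice. *)
pose s : 'S_n := perm (@rev_ord_inj n).
have -> : \matrix_(i, j) h (n - i.+1) (<< 1 *g lx j.+1 >> + 0)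
    = row_perm s (col_perm s (Vandermonde n x)).
  by apply/matrixP => i j; rewrite !mxE addr0 h_letter !permE rev_ordK.
rewrite row_permE col_permE !det_mulmx !det_perm odd_permV mulrCA -expr2 sqrr_sign mulr1.
rewrite det_Vandermonde (reindex_inj rev_ord_inj) /=.
under eq_bigr => i _ do rewrite (reindex_inj rev_ord_inj).
rewrite (exchange_big_dep xpredT) //=; apply: eq_bigr => i _.
apply: eq_big => [j|j _]; last by rewrite !mxE !rev_ordK.
by rewrite ltn_sub2lE.
Qed.

Lemma bialternantE (m : 'I_n -> nat) (Z : 'I_n -> alphabet) :
  \det (\matrix_(i, j) h (m i) (<< 1 *g lx j.+1 >> + Z i)) =
  \det (\matrix_(i, k) hshift (n - k.+1) (m i) (xsum n + Z i)) * g_den n.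
Proof. by rewrite bialternant_mx det_mulmx det_xdiff_mx. Qed.

End Bialternant.

(* Row [i] of the Jacobi-Trudi matrix for a part [a - r], possibly negative. *)
Definition jt_row (r k i a : nat) : 'rV[xpoly]_r :=
  \row_j hshift (i + r) (a + j) (xsum k - Asum (a - r).-1 + Bsum i).

Definition rows_det (r : nat) (f : nat -> 'rV[xpoly]_r) : xpoly :=
  \det (\matrix_(i < r) f i).

Lemma g_numE la n :
  g_num la n
    = rows_det (fun i => jt_row n n i (nth 0%N la i + n)) * g_den n.
Proof.
have e := bialternantE (fun i : 'I_n => nth 0 la i + n - i.+1)%N
            (fun i => - Asum (nth 0%N la i).-1 + Bsum i).
rewrite /g_num /rows_det.
under eq_mx => i j do rewrite -addrA.
rewrite e; apply: (congr1 (fun A => \det A * g_den n)).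
apply/matrixP => i j; rewrite !mxE addnK addrA /hshift.
have := ltn_ord i; have := ltn_ord j => jn i_n.
rewrite (_ : (n - j.+1 <= _)%N = (i + n <= nth 0 la i + n + j)%N); last by lia.
case: ifP => // ij; congr (h _ _); lia.
Qed.

(** * Recurrences and branching of the Jacobi-Trudi rows *)

Lemma AsumS k : Asum k.+1 = Asum k + << 1 *g lalpha k.+1 >>.
Proof. by rewrite /Asum big_nat_recr. Qed.

Lemma BsumS k : Bsum k.+1 = Bsum k + << 1 *g lbeta k.+1 >>.
Proof. by rewrite /Bsum big_nat_recr. Qed.

Lemma alternating_rows_det r : alternating_from r 0 (@rows_det r).
Proof.
split=> [j f a u v /andP[_ jr]|j f _ jr e].
  rewrite -[rows_det (upd f j v)]mul1r.
  apply: (@determinant_multilinear _ _ _ _ _ (Ordinal jr)).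
  - by rewrite !rowK !upd_same scale1r.
  - by apply/matrixP => i l; rewrite !mxE !upd_other // eq_sym neq_lift.
  - by apply/matrixP => i l; rewrite !mxE !upd_other // eq_sym neq_lift.
rewrite /rows_det.
apply: (@determinant_alternate _ _ _ (Ordinal (ltnW jr)) (Ordinal jr)).
  by rewrite -val_eqE /= neq_ltn ltnSn.
by move=> i; rewrite !mxE /= e.
Qed.

Lemma eq_rows_det r (f g : nat -> 'rV[xpoly]_r) :
  (forall i, (i < r)%N -> f i = g i) -> rows_det f = rows_det g.
Proof.
by move=> e; congr (\det _); apply/matrixP => i j; rewrite !mxE e.
Qed.

(** The letter by which the [Asum] of a row grows when its part [a - r] grows by 1; for parts at
    most 0 that sum stays empty. *)
Definition alpha_at (r a : nat) : xpoly :=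
  if (r < a)%N then letter_val (lalpha (a - r)) else 0.

Definition beta_above (i : nat) : xpoly :=
  if i is 0 then 0 else letter_val (lbeta i).

(* [jt_row_pred r k i.+1 a] is [jt_row r k i a] with the subscripts of [h]
   lowered by 1; the index 0 makes [jt_row_beta] hold for the first row too. *)
Definition jt_row_pred (r k i a : nat) : 'rV[xpoly]_r :=
  if i is i'.+1
  then \row_j hshift (i' + r).+1 (a + j) (xsum k - Asum (a - r).-1 + Bsum i')
  else jt_row r k 0 a.

(** This is what the offset [r] achieves: at [a = 0] the part is [-r], and the subscripts are
    negative in all [r] columns. *)
Lemma jt_row_pred0 r k i : jt_row_pred r k i.+1 0 = 0.
Proof.
apply/rowP => j; rewrite !mxE /hshift add0n ltnNge.
by rewrite (leq_trans (ltnW (ltn_ord j))) // leq_addl.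
Qed.

Lemma jt_rowS r k i a :
  jt_row r k.+1 i a
    = jt_row r k i a + letter_val (lx k.+1) *: jt_row_pred r k.+1 i.+1 a.
Proof.
apply/rowP => j; rewrite !mxE.
have -> : xsum k.+1 - Asum (a - r).-1 + Bsum i
    = xsum k - Asum (a - r).-1 + Bsum i + << 1 *g lx k.+1 >>.
  by rewrite xsumS [RHS]addrAC [xsum k + << _ *g _ >> + _]addrAC.
exact: hshiftD.
Qed.

(** Raising [a] undoes the lowering of the subscripts, so the two sides differ only by the letter
    that joins [Asum]. *)
Lemma jt_row_predS r k i a :
  jt_row_pred r k i.+1 a.+1
    = jt_row r k i a - alpha_at r a *: jt_row_pred r k i.+1 a.
Proof.
apply/rowP => j; rewrite !mxE addSn hshiftSS /alpha_at subSKn.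
case: leqP => [/eqP ar|ra]; first by rewrite ar mul0r subr0.
have a0 : (0 < a - r)%N by rewrite subn_gt0.
have -> : xsum k - Asum (a - r) + Bsum i
    = xsum k - Asum (a - r).-1 + Bsum i - << 1 *g lalpha (a - r) >>.
  by rewrite -{1}(prednK a0) AsumS (prednK a0) opprD addrA [RHS]addrAC.
exact: hshiftB.
Qed.

Lemma jt_row_beta r k i a :
  jt_row r k i a
    = beta_above i *: jt_row_pred r k i.+1 a + jt_row_pred r k i a.
Proof.
case: i => [|i]; first by rewrite scale0r add0r.
apply/rowP => j; rewrite !mxE.
have -> : xsum k - Asum (a - r).-1 + Bsum i.+1
    = xsum k - Asum (a - r).-1 + Bsum i + << 1 *g lbeta i.+1 >>.
  by rewrite BsumS addrA.
by rewrite [RHS]addrC; apply: hshiftD.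
Qed.

Lemma jt_branching r k K (la : nat -> nat) :
  (0 < K)%N -> (forall i, (i.+1 < r)%N -> (la i.+1 <= la i)%N) ->
  (forall i, (i < r)%N -> (la i < K)%N) ->
  rows_det (fun i => jt_row r k.+1 i (la i)) =
  \sum_(s <- words K r)
    weight K (letter_val (lx k.+1)) (alpha_at r) beta_above la s *
    rows_det (fun i => jt_row r k i (nth 0%N s i)).
Proof.
move=> K0 la_dec la_lt.
(* [branching] keeps a default content in the slots from [r] on, which the determinant does not
   see. *)
have rowsE (f : nat -> 'rV[xpoly]_r) :
    rows_det f = rows_det (fun j => if (j < r)%N then f j else 0).
  by apply: eq_rows_det => i ->.
rewrite rowsE.
rewrite (@branching _ _ r K (letter_val (lx k.+1)) (alpha_at r) beta_above la
  (jt_row r k) (jt_row r k.+1) (jt_row_pred r k.+1) _ _ _ _ la_dec la_lt _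
  (alternating_rows_det r) K0 (fun=> 0)).
- by apply: eq_bigr => s _; rewrite [in RHS]rowsE.
- by move=> i _; apply: jt_row_pred0.
- by move=> i a _; rewrite jt_row_predS jt_rowS scalerBl addrA.
- by move=> i a _; apply: jt_rowS.
- by move=> i a _; apply: jt_row_beta.
Qed.

(** * Shapes and fillings *)

Local Notation row := (@Defs.row _ _).
Local Notation col := (@Defs.col _ _).

Lemma prod_bipartition (R : comNzRingType) (I : finType) (P Q : pred I)
    (F : I -> R) a b :
  \prod_(i | P i && Q i) F i = a -> \prod_(i | P i && ~~ Q i) F i = b ->
  \prod_(i | P i) F i = b * a.
Proof. by move=> <- <-; rewrite (bigID Q) mulrC. Qed.

Lemma sum_seq_pred1 (V : nmodType) (I : eqType) (s : seq I) x (F : I -> V) :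
  uniq s -> x \in s -> \sum_(i <- s | i == x) F i = F x.
Proof.
move=> s_uniq xs; rewrite -big_filter.
have -> : [seq i <- s | i == x] = [:: x] by apply: filter_pred1_uniq.
by rewrite big_seq1.
Qed.

Section Cells.
Variable la : seq nat.
Hypothesis la_part : is_partition la.
Notation cell := (cell la [::]).

Lemma part_dec i : (nth 0%N la i.+1 <= nth 0%N la i)%N.
Proof.
case/andP: la_part => /(sortedP 0%N) s _.
by have [/s|/(nth_default 0%N) ->] := ltnP i.+1 (size la).
Qed.

Lemma part_head i : (nth 0%N la i <= nth 0%N la 0)%N.
Proof. by elim: i => // i; apply: leq_trans (part_dec i). Qed.

Lemma row_lt (c : cell) : (row c < size la)%N.
Proof. exact: ltn_ord. Qed.

Lemma col_lt (c : cell) : (col c < nth 0%N la (row c))%N.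
Proof. by have /andP[] := valP c. Qed.

Lemma cell_at i j : (j < nth 0%N la i)%N -> exists2 c : cell, row c = i & col c = j.
Proof.
move=> jl; have il : (i < size la)%N.
  by rewrite ltnNge; apply/negP => /(nth_default 0%N) e; rewrite e in jl.
have j0 := leq_trans jl (part_head i).
have p : (nth 0%N [::] (Ordinal il, Ordinal j0).1 <= (Ordinal il, Ordinal j0).2
           < nth 0 la (Ordinal il, Ordinal j0).1)%N by rewrite /= nth_nil.
by exists (Sub (Ordinal il, Ordinal j0) p : cell).
Qed.

Lemma cell_inj (c d : cell) : row c = row d -> col c = col d -> c = d.
Proof.
move=> er ec; apply: val_inj; apply/eqP; rewrite -pair_eqE /=.
by apply/andP; split; apply/eqP/val_inj.
Qed.

Lemma prod_cells (R : comNzRingType) (F : nat -> nat -> R) :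
  \prod_(c : cell) F (row c) (col c)
    = \prod_(0 <= i < size la) \prod_(0 <= j < nth 0%N la i) F i j.
Proof.
rewrite big_mkord.
transitivity (\prod_(i < size la) \prod_(j < nth 0%N la 0 | (j < nth 0%N la i)%N) F i j).
  rewrite pair_big_dep /=.
  rewrite [RHS](reindex_omap (val : cell -> _) insub) => [|p pl]; last first.
    by case: insubP => [c _ e|] /=; [rewrite -e | rewrite nth_nil pl].
  by apply: eq_bigl => c; rewrite (col_lt c) valK eqxx.
apply: eq_bigr => i _; rewrite big_mkord.
by rewrite (big_ord_widen _ (F i) (part_head i)).
Qed.

(* Row [i] of the shape [mu] has length [mu i - r]; [mu i < r] stands for a
   negative length, which occurs in the branching of determinants. *)
Variable r : nat.
Hypothesis la_le_r : (size la <= r)%N.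

Definition in_shape (mu : nat -> nat) (c : cell) : bool :=
  (col c + r < mu (row c))%N.

Definition subshape (mu lam : nat -> nat) : bool :=
  all (fun i => (r <= mu i <= lam i)%N && ((i.+1 < r)%N ==> (mu i.+1 <= mu i)%N))
    (iota 0 r).

Definition full_shape (i : nat) : nat := (nth 0%N la i + r)%N.

Lemma subshapeP mu lam :
  reflect ((forall i, (i < r)%N -> (r <= mu i <= lam i)%N) /\
           (forall i, (i.+1 < r)%N -> (mu i.+1 <= mu i)%N))
    (subshape mu lam).
Proof.
apply: (iffP allP) => [mu_ok|[mu_le mu_dec] i]; last first.
  rewrite mem_iota add0n => /= ir; rewrite mu_le //=; apply/implyP; exact: mu_dec.
by split=> i ir; have := mu_ok i; rewrite mem_iota /= add0n;
  [case/(_ ir)/andP | case/(_ (ltnW ir))/andP => _ /implyP]; last exact.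
Qed.

Lemma row_lt_r (c : cell) : (row c < r)%N.
Proof. exact: leq_trans (row_lt c) la_le_r. Qed.

Lemma subshape_trans lam mu nu : subshape mu lam -> subshape nu mu -> subshape nu lam.
Proof.
move=> /subshapeP[h1 d1] /subshapeP[h2 d2]; apply/subshapeP; split=> // i ir.
by have /andP[-> /leq_trans ->] := h2 _ ir; case/andP: (h1 _ ir).
Qed.

Lemma in_shape_sub lam mu c : subshape mu lam -> in_shape mu c -> in_shape lam c.
Proof.
move=> /subshapeP[h1 _]; rewrite /in_shape => /leq_trans; apply.
by case/andP: (h1 _ (row_lt_r c)).
Qed.

Definition adjacent (c d : cell) : bool := right_of c d || below c d.

Lemma in_shape_adjacent lam mu c d : subshape mu lam -> adjacent c d ->
  in_shape mu d -> in_shape mu c.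
Proof.
move=> /subshapeP[_ dec]; rewrite /in_shape.
case/orP=> /andP[/eqP er /eqP ec]; rewrite er ec; first by apply: ltn_trans.
by move=> /leq_trans; apply; apply: dec; rewrite -er row_lt_r.
Qed.

Lemma subshape_eq mu nu : subshape mu full_shape -> subshape nu full_shape ->
  in_shape mu =1 in_shape nu -> forall i, (i < r)%N -> mu i = nu i.
Proof.
have aux mu' nu' i : subshape mu' full_shape -> subshape nu' full_shape ->
    in_shape mu' =1 in_shape nu' -> (i < r)%N -> (mu' i <= nu' i)%N.
  move=> /subshapeP[h1 _] /subshapeP[h2 _] e ir; rewrite leqNgt; apply/negP => lt.
  have /andP[_] := h1 _ ir; rewrite /full_shape => mu_le.
  have /andP[r_le _] := h2 _ ir.
  (* The first cell of row [i] beyond [nu'] would lie in [mu'] only. *)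
  have [|c rc cc] := @cell_at i (nu' i - r); first lia.
  by have := e c; rewrite /in_shape rc cc subnK // ltnn lt.
move=> mu_ok nu_ok e i ir; apply/eqP; rewrite eqn_leq.
by apply/andP; split; apply: aux => // c; rewrite e.
Qed.

Definition monotone (t : cell -> nat) : bool :=
  [forall c, forall d, adjacent c d ==> (t c <= t d)%N].

Lemma monotoneP t :
  reflect (forall c d, adjacent c d -> (t c <= t d)%N) (monotone t).
Proof.
apply: (iffP forallP) => [H c d|H c]; first by move/forallP: (H c) => /(_ d)/implyP.
by apply/forallP => d; apply/implyP; apply: H.
Qed.

Lemma monotone_row t c d : monotone t -> row c = row d -> (col c <= col d)%N ->
  (t c <= t d)%N.
Proof.
move=> /monotoneP H; move e: (col d - col c)%N => n.
elim: n c e => [|n IH] c e er ec.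
  by rewrite (@cell_inj c d) //; lia.
have [|c' rc' cc'] := @cell_at (row c) (col c).+1.
  by have := col_lt d; rewrite -er; lia.
have cc1 : adjacent c c' by rewrite /adjacent /right_of rc' cc' !eqxx.
by apply: leq_trans (H _ _ cc1) (IH c' _ _ _); rewrite ?rc' ?cc' //; lia.
Qed.

Section ShapeOf.
Variables (n : nat) (t : cell -> nat).
Hypothesis t_mon : monotone t.

Definition row_length (i : nat) : nat :=
  \max_(c : cell | (row c == i) && (t c <= n)%N) (col c).+1.

Definition shape_of : seq nat := mkseq (fun i => row_length i + r)%N r.

Lemma in_shape_of c : in_shape (nth 0%N shape_of) c = (t c <= n)%N.
Proof.
rewrite /in_shape nth_mkseq ?row_lt_r // ltn_add2r.
apply/idP/idP => [|tn]; last first.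
  by rewrite (@leq_bigmax_cond _ _ (fun c : cell => (col c).+1)) ?eqxx.
case: (posnP #|[pred d : cell | (row d == row c) && (t d <= n)%N]|) => [e|].
  by rewrite /row_length big_pred0 // => d; have := card0_eq e d.
case/(eq_bigmax_cond (fun d : cell => (col d).+1)) => d; rewrite inE => /andP[/eqP er tn].
rewrite /row_length => ->; rewrite ltnS => cd.
exact: leq_trans (monotone_row t_mon _ cd) tn.
Qed.

Lemma subshape_shape_of lam : subshape lam full_shape ->
  (forall c, (t c <= n)%N -> in_shape lam c) -> subshape (nth 0%N shape_of) lam.
Proof.
move=> /subshapeP[lam_le _] t_lam.
apply/subshapeP; split=> i ir; last rewrite !nth_mkseq ?(ltnW ir) //.
  rewrite nth_mkseq // leq_addl /=; apply: leq_trans (_ : lam i - r + r <= _)%N; last first.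
    by rewrite subnK //; case/andP: (lam_le _ ir).
  rewrite leq_add2r; apply/bigmax_leqP => c /andP[/eqP er tn].
  by have := t_lam c tn; rewrite /in_shape er ltn_subRL addnC.
rewrite leq_add2r; apply/bigmax_leqP => c /andP[/eqP er tn].
have [|d rd cd] := @cell_at i (col c).
  by apply: leq_trans (part_dec i); rewrite -er col_lt.
rewrite -cd; apply: (@leq_bigmax_cond _ _ (fun c : cell => (col c).+1)).
rewrite rd eqxx /=.
apply: leq_trans tn; move/monotoneP: t_mon; apply.
by rewrite /adjacent /below er rd cd !eqxx orbT.
Qed.

End ShapeOf.

(** The counterpart of [step_factor] for actual cells: columns are counted from 0, and row 0 has no
    row above it. *)
Definition strip_factor (n : nat) (lam mu : nat -> nat) (i j : nat) : xpoly :=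
  (if (j.+1 + r < lam i)%N then - letter_val (lalpha j.+1) else 0) +
  (if (i == 0%N) || (j + r < mu i.-1)%N then letter_val (lx n.+1)
   else letter_val (lbeta i)).

Lemma weight_strip n K lam s :
  (full_shape 0 < K)%N -> size s = r -> subshape lam full_shape ->
  subshape (nth 0%N s) lam ->
  weight K (letter_val (lx n.+1)) (alpha_at r) beta_above lam s =
  \prod_(c | in_shape lam c && ~~ in_shape (nth 0%N s) c)
    strip_factor n lam (nth 0%N s) (row c) (col c).
Proof.
move=> full_K size_s /subshapeP[lam_le lam_dec] /subshapeP[s_le s_dec].
set mu := nth 0%N s.
pose F i j := if (j + r < lam i)%N && ~~ (j + r < mu i)%N
              then strip_factor n lam mu i j else 1.
rewrite big_mkcond /= (prod_cells F) /weight size_s.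
have -> : \prod_(0 <= i < size la) \prod_(0 <= j < nth 0%N la i) F i j
    = \prod_(0 <= i < r) \prod_(0 <= j < nth 0%N la i) F i j.
  rewrite [RHS](big_cat_nat (n := size la)) //= [X in _ * X]big_nat_cond.
  rewrite [X in _ * X]big1 ?mulr1 // => i /andP[/andP[li _] _].
  by rewrite nth_default // big_geq.
apply: eq_big_nat => i /= ir.
have /andP[r_lam lam_full] := lam_le _ ir; have /andP[r_mu mu_lam] := s_le _ ir.
rewrite /full_shape in lam_full full_K.
have mu_p : (mu i <= nth 0%N (K.-1 :: s) i)%N.
  case: i ir r_lam lam_full r_mu mu_lam => [|i] ir _ lam_full _ mu_lam /=.
    by apply: leq_trans mu_lam (leq_trans lam_full _); lia.
  exact: s_dec.
rewrite /step -/mu mu_p mu_lam /=.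
(* Column [j] of the cells is index [j + r.+1] of [step_factor]. *)
have e1 : (mu i).+1 = (mu i - r + r.+1)%N by rewrite addnS subnK.
rewrite e1 big_addn subSS (big_nat_widenl _ 0) // (big_nat_widen _ _ (nth 0%N la i));
  last by rewrite leq_subLR addnC.
rewrite big_mkcond; apply: eq_big_nat => j _ /=.
rewrite /F; rewrite (_ : (_ && _) = (j + r < lam i)%N && ~~ (j + r < mu i)%N);
  last by apply/idP/idP; lia.
case: ifP => // /andP[j_lam _]; rewrite /step_factor /strip_factor /alpha_at.
rewrite addnS addSn ltnS leq_addl (_ : (j + r).+1 - r = j.+1)%N; last by lia.
congr (_ + _).
(* In row 0 the fictitious length [K.-1] covers every column, so the variable is selected on both
   sides. *)
case: i ir r_lam lam_full r_mu mu_lam mu_p {e1} j_lam => [|i] ir _ lam_full _ _ _ j_lam.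
  have -> : (j + r < nth 0%N (K.-1 :: s) 0)%N; last by [].
  by clear -full_K lam_full j_lam => /=; lia.
by [].
Qed.

(** * Bounded fillings and their branching *)

Variable N : nat.
Notation filling := {ffun cell -> 'I_N.+1}.
Implicit Types T : filling.

Definition vals T : cell -> nat := fun c => T c.

(** The weights of the marked and the unmarked cell added up; whether a cell may be marked does not
    depend on the other marks, so products of these sums account for all sets of marks. *)
Definition cell_factor (t : cell -> nat) (c : cell) : xpoly :=
  (if [exists d, right_of c d && (t c == t d)]
   then - letter_val (lalpha (col c).+1) else 0) +
  (if [exists d, below d c && (t c == t d)]
   then letter_val (lbeta (row c)) else letter_val (lx (t c))).

(* A filling of [mu] by [1..n], extended to all cells of [la] by the value [n.+1]. *)
Definition fills (n : nat) (mu : nat -> nat) T : bool :=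
  [&& monotone (vals T), [forall c, (0 < vals T c <= n.+1)%N]
    & [forall c, (vals T c <= n)%N == in_shape mu c]].

Definition shape_sum (n : nat) (mu : nat -> nat) : xpoly :=
  \sum_(T | fills n mu T) \prod_(c | in_shape mu c) cell_factor (vals T) c.

Lemma fillsP n mu T :
  reflect [/\ forall c d, adjacent c d -> (vals T c <= vals T d)%N,
              forall c, (0 < vals T c <= n.+1)%N
            & forall c, (vals T c <= n)%N = in_shape mu c]
    (fills n mu T).
Proof.
apply: (iffP and3P) => [[/monotoneP ? /forallP ? /forallP e]|[? ? e]].
  by split=> // c; rewrite (eqP (e c)).
split; [exact/monotoneP | exact/forallP | apply/forallP => c].
by rewrite e.
Qed.

Lemma below_exists c : (0 < row c)%N -> exists2 d : cell, below d c & row d = (row c).-1.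
Proof.
move=> r0; have [|d rd cd] := @cell_at (row c).-1 (col c).
  by apply: leq_trans (col_lt c) _; rewrite -{1}(prednK r0) part_dec.
by exists d; rewrite // /below rd cd prednK ?eqxx.
Qed.

Lemma cell_factor_strip n lam mu T c : subshape lam full_shape ->
  fills n.+1 lam T -> (forall d, (vals T d <= n)%N = in_shape mu d) ->
  in_shape lam c -> ~~ in_shape mu c ->
  cell_factor (vals T) c = strip_factor n lam mu (row c) (col c).
Proof.
move=> /subshapeP[lam_le _] /fillsP[T_mon T_pos T_lam] T_mu c_lam c_mu.
have Tc : vals T c = n.+1.
  by apply/eqP; rewrite eqn_leq T_lam c_lam ltnNge T_mu.
have e1 : [exists d, right_of c d && (vals T c == vals T d)]
    = ((col c).+1 + r < lam (row c))%N.
  apply/existsP/idP => [[d /andP[cd /eqP Td]]|lt].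
    have : in_shape lam d by rewrite -T_lam -Td Tc.
    by case/andP: cd => /eqP rd /eqP cd; rewrite /in_shape rd cd.
  have [|d rd cd] := @cell_at (row c) (col c).+1.
    have /andP[_ ] := lam_le _ (row_lt_r c); rewrite /full_shape.
    by move=> /(leq_trans lt); rewrite ltn_add2r.
  have adj : right_of c d by rewrite /right_of rd cd !eqxx.
  exists d; rewrite adj Tc; have := T_mon c d; rewrite /adjacent adj Tc => /(_ isT).
  have : (vals T d <= n.+1)%N by rewrite T_lam /in_shape rd cd.
  by rewrite eqn_leq => -> ->.
have e2 : [exists d, below d c && (vals T c == vals T d)]
    = ~~ ((row c == 0%N) || (col c + r < mu (row c).-1)%N).
  case: (posnP (row c)) => [r0|r0].
    by rewrite r0; apply/negbTE/existsPn => d; rewrite /below r0.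
  have [d dc rd] := below_exists r0.
  have /andP[_ /eqP cd] := dc.
  rewrite /= cd -rd -[(_ < _)%N]/(in_shape mu d) -T_mu -ltnNge.
  apply/existsP/idP => [[d' /andP[/andP[/eqP rd' /eqP cd'] /eqP e]]|Td].
    by rewrite (@cell_inj d d') ?rd ?rd' -?cd // -e Tc.
  exists d; rewrite dc eqn_leq Tc Td /=.
  by have := T_mon d c; rewrite /adjacent dc orbT Tc => /(_ isT).
by rewrite /cell_factor /strip_factor e1 e2 if_neg Tc.
Qed.

(** From a filling of [mu] to one of [lam] with the new entry [n.+1]: the strip [lam/mu] keeps
    [n.+1], and the cells outside [lam] get the next filler value [n.+2]. *)
Definition lift_filling (n : nat) (lam : nat -> nat) T : filling :=
  [ffun c => if (T c <= n)%N then T c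
             else if in_shape lam c then inord n.+1 else inord n.+2].

Definition clip_filling (n : nat) T : filling :=
  [ffun c => if (T c <= n)%N then T c else inord n.+1].

Section Step.
Variables (n : nat) (lam : nat -> nat).
Hypothesis nN : (n.+2 <= N)%N.
Hypothesis lam_full : subshape lam full_shape.

Lemma vals_lift T c : vals (lift_filling n lam T) c =
  if (vals T c <= n)%N then vals T c else if in_shape lam c then n.+1 else n.+2.
Proof.
rewrite /vals ffunE; case: ifP => // _.
by case: ifP => _; rewrite inordK // ltnW.
Qed.

Lemma vals_clip T c : vals (clip_filling n T) c =
  if (vals T c <= n)%N then vals T c else n.+1.
Proof. by rewrite /vals ffunE; case: ifP => // _; rewrite inordK // ltnW. Qed.

Lemma vals_inj T T' : vals T =1 vals T' -> T = T'.
Proof. by move=> e; apply/ffunP => c; apply/val_inj/e. Qed.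

Lemma clipK T : fills n.+1 lam T -> lift_filling n lam (clip_filling n T) = T.
Proof.
case/fillsP=> _ T_pos T_lam; apply: vals_inj => c; rewrite vals_lift vals_clip.
have := T_lam c; have /andP[_] := T_pos c.
case: (leqP (vals T c) n) => [-> //|lt le <-].
rewrite ltnn; case: (leqP (vals T c) n.+1) => le'.
  by apply/eqP; rewrite eqn_leq lt.
by apply/eqP; rewrite eqn_leq le'.
Qed.

Definition compatible (mu : nat -> nat) T : bool :=
  [forall c, (vals T c <= n)%N == in_shape mu c].

(** The right side is the domain that [reindex_onto] produces for [lift_filling] and its inverse
    [clip_filling]. *)
Lemma fills_lift mu T : subshape mu lam ->
  fills n mu T = [&& fills n.+1 lam (lift_filling n lam T),
                     compatible mu (lift_filling n lam T)
                   & clip_filling n (lift_filling n lam T) == T].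
Proof.
move=> mu_lam; apply/fillsP/and3P => [[T_mon T_pos T_mu]|]; last first.
  case=> /fillsP[L_mon L_pos L_lam] /forallP L_mu /eqP clip.
  have T_clip c : vals T c = if (vals (lift_filling n lam T) c <= n)%N
      then vals (lift_filling n lam T) c else n.+1 by rewrite -{1}clip vals_clip.
  split=> [c d cd|c|c].
  - by have := L_mon _ _ cd; rewrite !T_clip; case: ifP => le_c; case: ifP => le_d; lia.
  - by have := L_pos c; rewrite T_clip; case: ifP => le_c; lia.
  - by rewrite T_clip -(eqP (L_mu c)); case: ifP => // _; rewrite ltnn.
have T_le c : (vals T c <= n.+1)%N by case/andP: (T_pos c).
split; last first.
- apply/eqP/vals_inj => c; rewrite vals_clip vals_lift.
  case: (leqP (vals T c) n) => [-> //|lt].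
  by have := T_le c; case: (in_shape lam c); case: ifP => le_n; lia.
- apply/forallP => c; rewrite vals_lift -T_mu.
  by case: ifP => [-> //|_]; case: ifP => _; apply/eqP; lia.
apply/fillsP; split=> [c d cd|c|c]; rewrite !vals_lift.
- have := T_mon _ _ cd; case: (leqP (vals T d) n) => [Td Tcd|Td _].
    by rewrite (leq_trans Tcd Td).
  have lc := in_shape_adjacent lam_full cd.
  case: (leqP (vals T c) n) => Tc; first by case: ifP => _; lia.
  by case: (boolP (in_shape lam d)) => [/lc -> //|_]; case: ifP => _; lia.
- case: ifP => [Tc|_]; last by case: ifP => _; lia.
  by case/andP: (T_pos c) => -> /= _; lia.
- case: (leqP (vals T c) n) => [Tc|_]; last by case: ifP => _; lia.
  rewrite (in_shape_sub mu_lam) -?T_mu //; lia.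
Qed.

Lemma cell_factor_lift mu T c : subshape mu lam -> fills n mu T ->
  in_shape mu c ->
  cell_factor (vals (lift_filling n lam T)) c = cell_factor (vals T) c.
Proof.
move=> mu_lam /fillsP[_ _ T_mu] c_mu.
have Tc : (vals T c <= n)%N by rewrite T_mu.
have eqd d : (vals (lift_filling n lam T) c == vals (lift_filling n lam T) d)
    = (vals T c == vals T d).
  rewrite !vals_lift Tc; case: (leqP (vals T d) n) => // lt.
  by case: ifP => _; apply/eqP/eqP; lia.
have Lc : vals (lift_filling n lam T) c = vals T c by rewrite vals_lift Tc.
rewrite /cell_factor Lc -Lc.
pose L := vals (lift_filling n lam T).
have e1 : [exists d, right_of c d && (L c == L d)]
    = [exists d, right_of c d && (vals T c == vals T d)].
  by apply: eq_existsb => d; rewrite eqd.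
have e2 : [exists d, below d c && (L c == L d)]
    = [exists d, below d c && (vals T c == vals T d)].
  by apply: eq_existsb => d; rewrite eqd.
by rewrite e1 e2 Lc.
Qed.

Lemma shape_sum_compatible mu : subshape mu lam ->
  \sum_(T | fills n.+1 lam T && compatible mu T)
     \prod_(c | in_shape lam c) cell_factor (vals T) c =
  (\prod_(c | in_shape lam c && ~~ in_shape mu c)
     strip_factor n lam mu (row c) (col c)) * shape_sum n mu.
Proof.
move=> mu_lam; rewrite /shape_sum mulr_sumr.
rewrite (reindex_onto (lift_filling n lam) (clip_filling n)) => [|T]; last first.
  by case/andP=> /clipK.
apply: eq_big => [T|T]; first by rewrite (fills_lift T mu_lam) andbA.
rewrite -andbA -(fills_lift T mu_lam) => T_mu.
have := T_mu; rewrite (fills_lift T mu_lam) => /and3P[L_fills /forallP L_mu _].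
have L_mu' d : (vals (lift_filling n lam T) d <= n)%N = in_shape mu d.
  exact: (eqP (L_mu d)).
have inside : \prod_(c | in_shape lam c && in_shape mu c)
      cell_factor (vals (lift_filling n lam T)) c
    = \prod_(c | in_shape mu c) cell_factor (vals T) c.
  apply: eq_big => [c|c /andP[_ c_mu]]; last exact: cell_factor_lift mu_lam T_mu c_mu.
  by rewrite andbC; case c_mu: (in_shape mu c); rewrite //= (in_shape_sub mu_lam c_mu).
have outside : \prod_(c | in_shape lam c && ~~ in_shape mu c)
      cell_factor (vals (lift_filling n lam T)) c
    = \prod_(c | in_shape lam c && ~~ in_shape mu c)
      strip_factor n lam mu (row c) (col c).
  apply: eq_bigr => c /andP[c_lam c_mu].
  exact: (cell_factor_strip lam_full L_fills L_mu' c_lam c_mu).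
exact: (prod_bipartition inside outside).
Qed.

(** The fillings are sorted by the shape of their entries at most [n]; [shape_of] is the only word
    compatible with a given filling, and the bound on [K] puts it among the words. *)
Lemma shape_sum_step K : (full_shape 0 < K)%N ->
  shape_sum n.+1 lam = \sum_(s <- words K r | subshape (nth 0%N s) lam)
    weight K (letter_val (lx n.+1)) (alpha_at r) beta_above lam s *
    shape_sum n (nth 0%N s).
Proof.
move=> full_K.
transitivity (\sum_(s <- words K r | subshape (nth 0%N s) lam)
    \sum_(T | fills n.+1 lam T && compatible (nth 0%N s) T)
       \prod_(c | in_shape lam c) cell_factor (vals T) c); last first.
  rewrite big_seq_cond [RHS]big_seq_cond; apply: eq_bigr => s /andP[s_in s_lam].
  move: s_in; rewrite mem_words => /andP[/eqP size_s _].
  by rewrite (weight_strip n full_K size_s lam_full s_lam) shape_sum_compatible.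
rewrite /shape_sum (exchange_big_dep (fills n.+1 lam)) /=; last first.
  by move=> s T _ /andP[].
apply: eq_bigr => T T_fills; have /fillsP[T_mon T_pos T_lam] := T_fills.
have T_monb : monotone (vals T) by apply/monotoneP.
have sh_lam : subshape (nth 0%N (shape_of n (vals T))) lam.
  by apply: subshape_shape_of => // c Tc; rewrite -T_lam leqW.
have sh_in : shape_of n (vals T) \in words K r.
  rewrite mem_words size_mkseq eqxx /=; apply/(all_nthP 0%N) => i.
  rewrite size_mkseq => ir.
  have /subshapeP[sh_le _] := subshape_trans lam_full sh_lam.
  have /andP[_ le] := sh_le _ ir; apply: leq_ltn_trans le _.
  by apply: leq_ltn_trans full_K; rewrite leq_add2r part_head.
rewrite [RHS]big_seq_cond [RHS](eq_bigl (fun s => s == shape_of n (vals T))) => [|s].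
  exact/esym/(sum_seq_pred1 _ (words_uniq _ _) sh_in).
rewrite T_fills -[RHS]/(s == _).
apply/idP/eqP => [/and3P[s_in s_lam /forallP s_T]|->]; last first.
  by rewrite sh_in sh_lam; apply/forallP => c; rewrite in_shape_of.
move: s_in; rewrite mem_words => /andP[/eqP size_s _].
apply: (@eq_from_nth _ 0%N) => [|i]; rewrite size_s ?size_mkseq // => ir.
apply: (subshape_eq _ _ _ ir).
- exact: subshape_trans s_lam.
- exact: subshape_trans sh_lam.
- by move=> c; rewrite in_shape_of // (eqP (s_T c)).
Qed.

End Step.

(** No positive entry is at most 0, so the shape must be empty; the only filling is then constant 1,
    the filler value for [n = 0]. *)
Lemma shape_sum0 lam : subshape lam full_shape -> (0 < N)%N ->
  shape_sum 0 lam = (all (fun i => lam i == r) (iota 0 r))%:R.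
Proof.
move=> /[dup] lam_full /subshapeP[lam_le lam_dec] N0; rewrite /shape_sum.
have [/allP lam_r|/allPn[i]] := boolP (all _ _).
  have out c : in_shape lam c = false.
    rewrite /in_shape (eqP (lam_r _ _)) ?mem_iota ?row_lt_r //.
    by rewrite ltnNge leq_addl.
  rewrite (big_pred1 [ffun=> inord 1]) => [|T]; first by rewrite big_pred0.
  apply/fillsP/eqP => [[_ T_pos _]|->].
    apply: vals_inj => c; rewrite /vals ffunE inordK //.
    by apply/eqP; rewrite eqn_leq andbC; apply: T_pos.
  by split=> [c d _|c|c]; rewrite /vals !ffunE inordK // out.
rewrite mem_iota => /= ir lam_i; rewrite big_pred0 // => T.
apply/negP => /fillsP[_ T_pos T_lam].
have /andP[r_le] := lam_le _ ir; rewrite /full_shape => le_full.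
have lt : (r < lam i)%N by rewrite ltn_neqAle eq_sym lam_i.
have [|c rc cc] := @cell_at i 0; first by lia.
have := T_lam c; rewrite /in_shape rc cc add0n lt; have := T_pos c; lia.
Qed.

End Cells.

(** * Equality of the Jacobi-Trudi determinant and the sum over fillings *)

Lemma rows_det_row0 r (f : nat -> 'rV[xpoly]_r) i :
  (i < r)%N -> f i = 0 -> rows_det f = 0.
Proof.
move=> ir fi; have -> : f = upd f i (0 *: 0).
  by apply: functional_extensionality => j; rewrite /upd scaler0; case: eqP => [->|].
by rewrite (alternatingZ (@alternating_rows_det r)) // mul0r.
Qed.

Lemma prod_nat_eq0 (R : comNzRingType) (F : nat -> R) n i :
  (i < n)%N -> F i = 0 -> \prod_(0 <= j < n) F j = 0.
Proof.
move=> i_n Fi; rewrite big_mkord (bigD1 (Ordinal i_n)) //= Fi mul0r //.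
Qed.

Lemma sum_seq_restrict (V : nmodType) (I : eqType) (s : seq I) (P : pred I)
    (F G : I -> V) :
  (forall i, i \in s -> P i -> F i = G i) ->
  (forall i, i \in s -> ~~ P i -> F i = 0) ->
  \sum_(i <- s) F i = \sum_(i <- s | P i) G i.
Proof.
move=> FG F0; rewrite [RHS]big_mkcond [LHS]big_seq [RHS]big_seq.
by apply: eq_bigr => i si; case: ifPn => Pi; [apply: FG | apply: F0].
Qed.

Lemma hB_Asum_eq0 k m : (k < m)%N -> h m (- Asum k) = 0.
Proof.
move=> km.
rewrite /Asum -(big_map lalpha xpredT (fun u => << 1 *g u >>)) hB_eq0 //.
by rewrite size_map size_iota subn1.
Qed.

Section JacobiTrudi.
Variables (la : seq nat) (r : nat).
Hypothesis la_part : is_partition la.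
Hypothesis la_le_r : (size la <= r)%N.
Let full := full_shape la r.

(** For the empty shape the matrix is unitriangular. Otherwise the first part l is positive, and the
    first row consists of [h] of degree at least l in minus l - 1 letters, hence vanishes. *)
Lemma jt_base lam : subshape r lam full ->
  rows_det (fun i => jt_row r 0 i (lam i))
    = (all (fun i => lam i == r) (iota 0 r))%:R.
Proof.
move=> /subshapeP[lam_le lam_dec].
have [/allP lam_r|/allPn[i]] := boolP (all _ _).
  have lamE i : (i < r)%N -> lam i = r.
    by move=> ir; apply/eqP/lam_r; rewrite mem_iota.
  rewrite /rows_det -det_tr det_trig; last first.
    apply/is_trig_mxP => i j ij; rewrite !mxE lamE // addnC.
    by rewrite /hshift leq_add2l leqNgt ij.
  by rewrite big1 // => i _; rewrite !mxE lamE // addnC /hshift leqnn subnn h_at0.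
rewrite mem_iota => /= ir lam_i.
have r0 : (0 < r)%N by apply: leq_ltn_trans ir.
have lam0 : (r < lam 0)%N.
  have : (r < lam i)%N by rewrite ltn_neqAle eq_sym lam_i; case/andP: (lam_le _ ir).
  elim: i ir {lam_i} => // i IH ir lt.
  by apply: IH (ltnW ir) (leq_trans lt (lam_dec _ ir)).
apply: (rows_det_row0 r0); apply/rowP => j; rewrite !mxE /hshift ifT; last lia.
rewrite /xsum big_ord0 sub0r /Bsum big_geq // addr0.
by apply: hB_Asum_eq0; lia.
Qed.

(** Either some [step] is zero, or the word is decreasing and bounded by [lam] but has a negative
    part; its last part is then negative, and the last row of the determinant is zero. *)
Lemma branch_vanish k K lam s : (full 0 < K)%N -> subshape r lam full ->
  size s = r -> ~~ subshape r (nth 0%N s) lam ->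
  weight K (letter_val (lx k.+1)) (alpha_at r) beta_above lam s *
    rows_det (fun i => jt_row r k i (nth 0%N s i)) = 0.
Proof.
move=> full_K /subshapeP[lam_le lam_dec] size_s s_lam.
pose good i := (nth 0%N s i <= nth 0%N (K.-1 :: s) i)%N && (nth 0%N s i <= lam i)%N.
have [/allP s_good|/allPn[i]] := boolP (all good (iota 0 r)); last first.
  rewrite mem_iota => /= ir bad; rewrite /weight size_s (prod_nat_eq0 ir) ?mul0r //.
  by rewrite /step -/(good i) (negbTE bad).
have {}s_good i : (i < r)%N -> good i by move=> ir; apply: s_good; rewrite mem_iota.
have s_dec i : (i.+1 < r)%N -> (nth 0 s i.+1 <= nth 0 s i)%N.
  by move=> /s_good/andP[].
have [/allP r_le|/allPn[i]] := boolP (all (fun i => r <= nth 0 s i)%N (iota 0 r)).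
  case/negP: s_lam; apply/subshapeP; split=> // i ir.
  by rewrite r_le ?mem_iota //; case/andP: (s_good _ ir).
rewrite mem_iota -ltnNge => /= ir s_i.
have r0 : (0 < r)%N by apply: leq_ltn_trans ir.
have last_lt : (nth 0 s r.-1 < r)%N.
  have aux d : (i + d < r)%N -> (nth 0 s (i + d) < r)%N.
    elim: d => [|d IH]; first by rewrite addn0.
    rewrite addnS => lt; exact: leq_ltn_trans (s_dec _ lt) (IH (ltnW lt)).
  by have := aux (r.-1 - i)%N; rewrite subnKC; [apply; lia | lia].
rewrite (@rows_det_row0 _ _ r.-1) ?mulr0 ?prednK //.
by apply/rowP => j; rewrite !mxE /hshift ifF //; have := ltn_ord j; lia.
Qed.

Lemma jt_shape_sum N n lam : (n < N)%N -> subshape r lam full ->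
  rows_det (fun i => jt_row r n i (lam i)) = shape_sum la r N n lam.
Proof.
elim: n lam => [|n IH] lam nN lam_full.
  by rewrite jt_base // (shape_sum0 la_part la_le_r).
have /subshapeP[lam_le lam_dec] := lam_full.
have full0 : (full 0 < (full 0).+1)%N by [].
rewrite (shape_sum_step la_part la_le_r nN lam_full full0).
have lam_lt i : (i < r)%N -> (lam i < (full 0).+1)%N.
  move=> ir; case/andP: (lam_le _ ir) => _ le; rewrite ltnS.
  by apply: leq_trans le _; rewrite leq_add2r part_head.
apply: etrans (jt_branching n (ltn0Sn _) lam_dec lam_lt) _.
apply: sum_seq_restrict => s; rewrite mem_words => /andP[/eqP size_s _] s_lam.
  by rewrite IH ?(ltnW nN) // (subshape_trans lam_full s_lam).
exact: branch_vanish.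
Qed.

End JacobiTrudi.

(** * Regularity of the denominator *)

Lemma letter_val_lx i : letter_val (lx i.+1) = << 1 *g ucm i >>.
Proof. by []. Qed.

Lemma mcoeff_mulU (p : xpoly) (k m : {cmonom nat}) :
  mcoeff m (p * << 1 *g k >>) = \sum_(l <- msupp p) mcoeff l p *+ (mmul l k == m).
Proof.
rewrite malgM_def fgmulgU raddf_sum /=; apply: eq_bigr => l _.
by rewrite mcoeffU mulr1.
Qed.

Lemma mcoeff_mulU_shift (p : xpoly) (k m : {cmonom nat}) :
  mcoeff (mmul m k) (p * << 1 *g k >>) = mcoeff m p.
Proof.
have canc (l : {cmonom nat}) : (mmul l k == mmul m k) = (l == m).
  apply/eqP/eqP => [e|-> //]; apply/eqP/cmP => i.
  by have := congr1 (fun u : {cmonom nat} => u i) e; rewrite !cmM => /addIn.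
rewrite mcoeff_mulU; under eq_bigr do rewrite canc.
case: (boolP (m \in msupp p)) => mp.
  rewrite (big_fsetD1 m) //= eqxx mulr1n big_seq big1 ?addr0 // => l.
  by rewrite in_fsetD1 => /andP[/negbTE -> _].
rewrite mcoeff_outdom // big_seq big1 // => l lp; case: eqP => // e.
by rewrite -e lp in mp.
Qed.

Lemma seq_argmax (I : eqType) (s : seq I) (F : I -> nat) x0 : x0 \in s ->
  exists2 x, x \in s & forall y, y \in s -> (F y <= F x)%N.
Proof.
elim: s x0 => // z s IH x0 _; case: s IH => [_|z' s IH].
  by exists z => [|y]; rewrite ?inE // => /eqP ->.
have [x xs x_max] := IH z' (mem_head _ _).
have [zx|xz] := leqP (F z) (F x).
  exists x => [|y]; first by rewrite inE xs orbT.
  by rewrite inE => /orP[/eqP ->|/x_max].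
exists z => [|y]; first exact: mem_head.
by rewrite inE => /orP[/eqP ->|/x_max yx] //; apply: leq_trans yx (ltnW xz).
Qed.

(** A monomial of [p] with the largest exponent of the variable [i], multiplied by that variable,
    cannot occur in [p] times the variable [j]. *)
Lemma lx_sub_regular (i j : nat) (p : xpoly) : i != j ->
  p * (letter_val (lx i.+1) - letter_val (lx j.+1)) = 0 -> p = 0.
Proof.
move=> ij; rewrite mulrBr => /eqP; rewrite subr_eq0 !letter_val_lx => /eqP e.
apply/eqP; rewrite -msupp_eq0; apply/negPn/negP => /fset0Pn[m0 m0p].
have [m mp m_max] := seq_argmax (fun m : {cmonom nat} => m i) m0p.
have := mcoeff_mulU_shift p (ucm i) m; rewrite e mcoeff_mulU.
rewrite big_seq big1 => [/esym/eqP|l lp]; first by rewrite mcoeff_eq0 mp.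
have -> : (mmul l (ucm j) == mmul m (ucm i)) = false; last exact: mulr0n.
apply/negP => /eqP/(congr1 (fun u : {cmonom nat} => u i)).
rewrite !cmM !ucmE eqxx eq_sym (negbTE ij) addn0 addn1 => li.
by have := m_max l lp; rewrite li ltnn.
Qed.

Lemma rreg_prod (R : comNzRingType) (I : Type) (s : seq I) (P : pred I) (F : I -> R) :
  (forall i, P i -> GRing.rreg (F i)) -> GRing.rreg (\prod_(i <- s | P i) F i).
Proof.
move=> reg; elim/big_ind: _ => //; first exact: GRing.rreg1.
exact: GRing.rregM.
Qed.

Lemma lx_sub_rreg (i j : nat) : i != j ->
  @GRing.rreg xpoly (letter_val (lx i.+1) - letter_val (lx j.+1)).
Proof.
move=> ij p q /eqP; rewrite -subr_eq0 -mulrBl => /eqP/(lx_sub_regular ij)/eqP.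
by rewrite subr_eq0 => /eqP.
Qed.

Lemma g_den_rreg n : @GRing.rreg xpoly (g_den n).
Proof.
apply: rreg_prod => i _; apply: rreg_prod => j ij; apply: lx_sub_rreg.
by rewrite neq_ltn ij.
Qed.

(** * Marked reverse plane partitions *)

Lemma malgU_mul (p q : coefring) (k l : {cmonom nat}) :
  (<< p *g k >> : xpoly) * << q *g l >> = << p * q *g mmul k l >>.
Proof. exact: fgmulUU. Qed.

Lemma prod_monomials (I : Type) (s : seq I) (F : I -> xpoly) (m : I -> {cmonom nat}) :
  (forall i, exists a, F i = << a *g m i >>) ->
  exists a, exists2 M : {cmonom nat}, \prod_(i <- s) F i = << a *g M >>
    & forall k, M k = (\sum_(i <- s) m i k)%N.
Proof.
move=> Fm; elim: s => [|i s [a [M eM sM]]].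
  exists 1, mone => [|k]; first exact: big_nil.
  by rewrite big_nil cm1.
have [b eb] := Fm i; exists (b * a), (mmul (m i) M).
  by rewrite [LHS]big_cons eb eM; exact: malgU_mul.
by move=> k; rewrite big_cons cmM sM.
Qed.

Section Marked.
Variable la : seq nat.
Notation cell := (cell la [::]).
Notation marked := (marked_filling la [::]).
Implicit Types x : marked.

Definition carries_variable x (c : cell) : bool :=
  (c \notin x.2) && ~~ [exists d, below d c && (x.1 c == x.1 d)].

Lemma wt_monomial x : exists a, exists2 M : {cmonom nat}, wt x = << a *g M >>
  & forall k, M k = (\sum_(c : cell) (carries_variable x c && ((x.1 c).-1 == k)))%N.
Proof.
pose m c : {cmonom nat} := if carries_variable x c then ucm (x.1 c).-1 else mone.
have [c|a [M eM sM]] := @prod_monomials _ (index_enum cell) (cell_weight x) m.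
  rewrite /cell_weight /m /carries_variable.
  case: (c \in x.2) => /=.
    eexists; rewrite /letter_val /= -monalgUN; reflexivity.
  by case: ifP => _; eexists; reflexivity.
exists a, M => // k; rewrite sM; apply: eq_bigr => c _.
by rewrite /m; case: ifP => _; rewrite ?ucmE ?cm1.
Qed.

Lemma mcoeff_wt_neq0 x (m : {cmonom nat}) k : mcoeff m (wt x) != 0 ->
  (k \in finsupp m) = [exists c, carries_variable x c && ((x.1 c).-1 == k)].
Proof.
have [a [M -> sM]] := wt_monomial x; rewrite mcoeffU.
case: (eqVneq M m) => [<-|_]; last by rewrite mulr0n eqxx.
move=> _; rewrite -cmE_neq0 sM sum_nat_eq0; apply/forallPn/existsP => -[c].
  by rewrite /= eqb0 negbK => cc; exists c.
by move=> cc; exists c; rewrite /= cc.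
Qed.

Lemma mrppP x :
  reflect [/\ forall c, (0 < x.1 c)%N,
              forall c d, adjacent c d -> (x.1 c <= x.1 d)%N
            & forall c, c \in x.2 -> exists2 d, right_of c d & x.1 c = x.1 d]
    (is_mrpp x).
Proof.
apply: (iffP andP) => [[/and3P[/forallP T0 /forallP T_right /forallP T_below]]|].
  move/forallP=> M_ok.
  split=> // [c d /orP[cd|cd]|c cM].
  - by apply: (implyP (forallP (T_right c) d)).
  - by apply: (implyP (forallP (T_below c) d)).
  - by have /existsP[d /andP[cd /eqP e]] := implyP (M_ok c) cM; exists d.
case=> T0 T_adj M_ok; split.
  apply/and3P; split; first exact/forallP.
  - by apply/forallP => c; apply/forallP => d; apply/implyP => cd;
      apply: T_adj; rewrite /adjacent cd.
  - by apply/forallP => c; apply/forallP => d; apply/implyP => cd;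
      apply: T_adj; rewrite /adjacent cd orbT.
apply/forallP => c; apply/implyP => /M_ok[d cd e].
by apply/existsP; exists d; rewrite cd e eqxx.
Qed.

(* Among the cells with a given value, the rightmost one in the topmost row is
   neither marked nor below an equal entry. *)
Lemma value_carried x c : is_mrpp x ->
  exists2 d, carries_variable x d & x.1 d = x.1 c.
Proof.
case/mrppP => _ _ M_ok.
pose P1 d := x.1 d == x.1 c.
case: (@arg_minnP _ c P1 (fun d : cell => row d) (eqxx _)) => c1 /eqP e1 c1_min.
have c1P : (x.1 c1 == x.1 c) && (row c1 == row c1) by rewrite e1 !eqxx.
pose P d := (x.1 d == x.1 c) && (row d == row c1).
case: (@arg_maxnP _ c1 P (fun d : cell => col d) c1P) => c2 /andP[/eqP e2 /eqP r2] c2_max.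
exists c2 => //; apply/andP; split.
  apply/negP => /M_ok[d /andP[/eqP rd /eqP cd] e].
  have /c2_max : P d by rewrite /P -e e2 rd r2 !eqxx.
  by rewrite cd /= ltnn.
apply/negP => /existsP[d /andP[/andP[/eqP rd _] /eqP e]].
have /c1_min : P1 d by rewrite /P1 -e e2.
by rewrite -r2 rd ltnn.
Qed.

(** Although marks and betas replace variables, [value_carried] ensures that each entry still
    contributes its own. A monomial thus bounds the entries, which makes the sum formally finite. *)
Lemma mcoeff_wt_values x (m : {cmonom nat}) : is_mrpp x -> mcoeff m (wt x) != 0 ->
  (forall c, (x.1 c).-1 \in finsupp m) /\
  (forall k, k \in finsupp m -> exists c, (x.1 c).-1 = k).
Proof.
move=> x_ok /mcoeff_wt_neq0 mx; split=> [c|k].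
  have [d dv ed] := value_carried c x_ok.
  by rewrite mx; apply/existsP; exists d; rewrite dv ed eqxx.
by rewrite mx => /existsP[c /andP[_ /eqP e]]; exists c.
Qed.

Definition bounded (n : nat) x : bool := [forall c, (x.1 c <= n)%N].

Definition embed (n : nat) (p : {ffun cell -> 'I_n.+2} * {set cell}) : marked :=
  ([ffun c => nat_of_ord (p.1 c)], p.2).

Definition is_bounded_mrpp n p := is_mrpp (@embed n p) && bounded n (@embed n p).

Definition mrpps (n : nat) : {fset marked} :=
  [fset x in [seq embed p | p <- enum (@is_bounded_mrpp n)]]%fset.

Lemma embed_inj n : injective (@embed n).
Proof.
move=> [T M] [T' M'] [eT ->]; congr (_, _); apply/ffunP => c; apply: val_inj.
by have /ffunP/(_ c) := eT; rewrite !ffunE.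
Qed.

Lemma mem_mrpps n x : (x \in mrpps n) = is_mrpp x && bounded n x.
Proof.
rewrite /mrpps inE; apply/mapP/idP => [[p]|/andP[x_ok /forallP x_n]].
  by rewrite mem_enum => p_ok ->.
case: x x_ok x_n => T M x_ok x_n.
have e : (T, M) = embed ([ffun c => inord (T c)] : {ffun cell -> 'I_n.+2}, M).
  congr (_, _); apply/ffunP => c; rewrite !ffunE inordK //.
  exact: leqW (x_n c).
exists ([ffun c => inord (T c)] : {ffun cell -> 'I_n.+2}, M) => //.
by rewrite mem_enum unfold_in /is_bounded_mrpp -e x_ok; apply/forallP.
Qed.

Lemma sum_mrpps (V : nmodType) n (F : marked -> V) :
  \sum_(x <- mrpps n) F x = \sum_(p | is_bounded_mrpp p) F (@embed n p).
Proof.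
rewrite -big_enum -(big_map (@embed n) xpredT F); apply: perm_big.
apply: uniq_perm; rewrite ?fset_uniq ?map_inj_uniq ?enum_uniq //; first exact: embed_inj.
by move=> x; rewrite -[LHS]/(x \in mrpps n) /mrpps inE.
Qed.

Definition mrpp_poly (n : nat) : xpoly := \sum_(x <- mrpps n) wt x.

End Marked.

(** * Expansion over the sets of marks *)

Lemma prod_addif (R : comNzRingType) (I : finType) (A : pred I) (F G : I -> R) :
  \prod_i ((if A i then F i else 0) + G i)
    = \sum_(J : {set I} | [forall i in J, A i]) \prod_i (if i \in J then F i else G i).
Proof.
rewrite bigA_distr (bigID (fun J : {set I} => [forall i in J, A i])) /=.
rewrite [X in _ + X]big1 ?addr0 => [|J].
  apply: eq_bigr => J /forallP JA; apply: eq_bigr => i _.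
  by case: ifP => // iJ; rewrite (implyP (JA i) iJ).
rewrite negb_forall => /existsP[i]; rewrite negb_imply => /andP[iJ iA].
by rewrite (bigD1 i) //= iJ (negbTE iA) mul0r.
Qed.

Lemma sum_pairs (V : nmodType) (I J : finType) (P : pred I) (Q : I -> pred J)
    (S : pred (I * J)) (F : I * J -> V) :
  (forall i j, P i && Q i j = S (i, j)) ->
  \sum_(i | P i) \sum_(j | Q i j) F (i, j) = \sum_(p | S p) F p.
Proof.
by move=> PQS; rewrite pair_big_dep; apply: eq_big => [[i j]|[i j] _] /=.
Qed.

Section ShapeSum.
Variables (la : seq nat) (r : nat).
Hypothesis la_part : is_partition la.
Hypothesis la_le_r : (size la <= r)%N.
Notation cell := (cell la [::]).

Lemma subshape_full : subshape r (full_shape la r) (full_shape la r).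
Proof.
apply/subshapeP; split=> i _; first by rewrite leq_addl leqnn.
by rewrite leq_add2r part_dec.
Qed.

Lemma fills_full n (T : {ffun cell -> 'I_n.+2}) (J : {set cell}) :
  fills r n (full_shape la r) T &&
    [forall c in J, [exists d, right_of c d && (vals T c == vals T d)]]
  = is_bounded_mrpp (T, J).
Proof.
have in_full c : in_shape r (full_shape la r) (c : cell).
  by rewrite /in_shape /full_shape ltn_add2r col_lt.
have eT c : (embed (T, J)).1 c = vals T c by rewrite ffunE.
apply/andP/andP => [[/fillsP[T_adj T_pos T_le] /forallP J_ok]|].
  split; last by apply/forallP => c; rewrite eT T_le.
  apply/mrppP; split=> [c|c d|c cJ]; rewrite ?eT.
  - by case/andP: (T_pos c).
  - exact: T_adj.
  - have /existsP[d /andP[cd /eqP e]] := implyP (J_ok c) cJ.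
    by exists d => //; rewrite eT.
case=> /mrppP[T0 T_adj J_ok] /forallP T_n; split.
  apply/fillsP; split=> [c d /T_adj|c|c]; rewrite ?eT //.
    by have := T0 c; have := T_n c; rewrite !eT => /leqW -> ->.
  by rewrite in_full -eT; apply: T_n.
apply/forallP => c; apply/implyP => /J_ok[d cd]; rewrite !eT => e.
by apply/existsP; exists d; rewrite cd e eqxx.
Qed.

(** All cells lie in the full shape, so the product of the [cell_factor] runs over every cell;
    [prod_addif] expands it over the sets of markable cells. *)
Lemma shape_sum_mrpp n :
  shape_sum la r n.+1 n (full_shape la r) = mrpp_poly la n.
Proof.
rewrite /mrpp_poly sum_mrpps /shape_sum.
transitivity (\sum_(T : {ffun cell -> 'I_n.+2} | fills r n (full_shape la r) T)
  \sum_(J : {set cell} | [forall c in J, [exists d, right_of c d && (vals T c == vals T d)]])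
     wt (embed (T, J))).
  apply: eq_bigr => T _; rewrite (eq_bigl xpredT) => [|c]; last first.
    by rewrite /in_shape /full_shape ltn_add2r col_lt.
  apply: etrans (prod_addif _ _ _) _; apply: eq_bigr => J _.
  have eT : fun_of_fin (embed (T, J)).1 = vals T :> (cell -> nat).
    by apply: functional_extensionality => c; rewrite ffunE.
  by apply: eq_bigr => c _; rewrite /cell_weight eT.
apply: (sum_pairs (fun p => wt (embed p))) => T J; exact: fills_full.
Qed.

Lemma is_g_fin_mrpp : is_g_fin la r (mrpp_poly la r).
Proof.
rewrite /is_g_fin g_numE -shape_sum_mrpp -(jt_shape_sum la_part la_le_r) //.
exact: subshape_full.
Qed.

End ShapeSum.

(** * The formal sum and the uniqueness of the series *)

Definition support_bound (m : {cmonom nat}) : nat := sumn [seq i.+1 | i <- finsupp m].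

Lemma support_boundP (m : {cmonom nat}) i : i \in finsupp m -> (i < support_bound m)%N.
Proof.
rewrite /support_bound -[i \in _]/(i \in enum_fset _).
elim: (enum_fset _) => //= j s IH; rewrite inE => /orP[/eqP ->|/IH lt].
  exact: leq_addr.
exact: leq_trans lt (leq_addl _ _).
Qed.

Section FormalSum.
Variable la : seq nat.

Lemma mcoeff_wt_unbounded n (x : marked_filling la [::]) (m : {cmonom nat}) :
  (forall i, i \in finsupp m -> (i < n)%N) -> is_mrpp x -> ~~ bounded n x ->
  mcoeff m (wt x) = 0.
Proof.
move=> m_n x_ok /forallPn[c]; rewrite -ltnNge => lt; apply/eqP/negPn/negP.
move=> /(mcoeff_wt_values x_ok)[/(_ c)/m_n + _].
by rewrite ltnNge -ltnS prednK ?lt // (leq_ltn_trans _ lt).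
Qed.

Lemma mcoeff_mrpp_poly n m :
  mcoeff m (mrpp_poly la n) = \sum_(x <- mrpps la n) mcoeff m (wt x).
Proof. exact: raddf_sum. Qed.

Lemma mcoeff_mrpp_poly_stable n n' (m : {cmonom nat}) :
  (forall i, i \in finsupp m -> (i < n)%N) -> (n <= n')%N ->
  mcoeff m (mrpp_poly la n) = mcoeff m (mrpp_poly la n').
Proof.
move=> m_n nn'; rewrite !mcoeff_mrpp_poly; apply: big_fset_incl.
  apply/fsubsetP => x; rewrite !mem_mrpps => /andP[-> /forallP x_n].
  by apply/forallP => c; apply: leq_trans (x_n c) nn'.
move=> x; rewrite !mem_mrpps => /andP[x_ok _]; rewrite x_ok /=.
exact: mcoeff_wt_unbounded.
Qed.

Lemma mcoeff_mrpp_poly_out n i (m : {cmonom nat}) :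
  i \in finsupp m -> (n <= i)%N -> mcoeff m (mrpp_poly la n) = 0.
Proof.
move=> im ni; rewrite mcoeff_mrpp_poly big_seq big1 // => x.
rewrite mem_mrpps => /andP[x_ok /forallP x_n]; apply/eqP/negPn/negP.
move=> /[dup] /(mcoeff_wt_values x_ok)[_ /(_ i im)[c ec]] _.
have := x_n c; have /mrppP[/(_ c) x0 _ _] := x_ok; lia.
Qed.

(** Each coefficient is read off with enough variables to contain [m]; more variables do not change
    it, by [mcoeff_mrpp_poly_stable]. *)
Definition mrpp_series : xseries := fun m => mcoeff m (mrpp_poly la (support_bound m)).

Lemma mrpp_series_formal_sum : is_formal_sum (@is_mrpp la [::]) (@wt la [::]) mrpp_series.
Proof.
move=> m; exists (mrpps la (support_bound m)); split.
- by move=> x; rewrite mem_mrpps => /andP[].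
- move=> x x_ok; rewrite mem_mrpps x_ok /=.
  exact: mcoeff_wt_unbounded (@support_boundP m) x_ok.
- exact: mcoeff_mrpp_poly.
Qed.

Lemma specialize_mrpp_series n m :
  specialize n mrpp_series m = mcoeff m (mrpp_poly la n).
Proof.
rewrite /specialize; case: ifP => [/allP m_n|/negbT/allPn[i im]]; last first.
  by rewrite -leqNgt => ni; rewrite (mcoeff_mrpp_poly_out im ni).
rewrite /mrpp_series.
have [le|lt] := leqP n (support_bound m).
  exact/esym/mcoeff_mrpp_poly_stable.
exact: mcoeff_mrpp_poly_stable (@support_boundP m) (ltnW lt).
Qed.

Hypothesis la_part : is_partition la.

Lemma is_g_mrpp_series : is_g la mrpp_series.
Proof.
move=> n la_n; exists (mrpp_poly la n); first exact: is_g_fin_mrpp.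
exact: specialize_mrpp_series.
Qed.

Lemma is_g_unique (G G' : xseries) : is_g la G -> is_g la G' -> G = G'.
Proof.
move=> gG gG'; apply: functional_extensionality => m.
(* Enough variables for the quotient to be prescribed and for the specialization to keep the
   coefficient of [m]. *)
pose n := maxn (size la) (support_bound m).
have [q qG eG] := gG n (leq_maxl _ _); have [q' qG' eG'] := gG' n (leq_maxl _ _).
have eq : q = q' by apply: (@g_den_rreg n); rewrite [LHS]qG [RHS]qG'.
have full : all (fun i => i < n)%N (finsupp m).
  by apply/allP => i /support_boundP lt; apply: leq_trans lt (leq_maxr _ _).
have := eG m; have := eG' m; rewrite /specialize full eq => -> ->.
by [].
Qed.

End FormalSum.

Theorem theorem7p2 (la : seq nat) (hla : is_partition la) :
  exists G : xseries,
    unique (is_g la) G /\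
    is_formal_sum (@is_mrpp la [::]) (@wt la [::]) G.
Proof.
exists (mrpp_series la); split; last exact: mrpp_series_formal_sum.
split; first exact: is_g_mrpp_series.
by move=> G; apply: is_g_unique; apply: is_g_mrpp_series.
Qed.
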